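(* Let $1<p<\infty$ and $\Lambda>1$. There are constants $0<c\le C<\infty$ depending only on $\Lambda$, $p$ and $n$ such that for every weight $w\in A_p^{\mathcal{D}}$ on $\mathbb{R}^n$, $$c\,\sup_{a,b}\frac{\|\Pi_a^*\Pi_b:L^p(w)\to L^p(w)\|}{\|a\|_{BMO^{\mathcal{D}}}\|b\|_{BMO^{\mathcal{D}}}}\le\sup_{\mathcal{S}}\|\mathcal{A}_{\mathcal{S}}:L^p(w)\to L^p(w)\|\le C\,\sup_{a,b}\frac{\|\Pi_a^*\Pi_b:L^p(w)\to L^p(w)\|}{\|a\|_{BMO^{\mathcal{D}}}\|b\|_{BMO^{\mathcal{D}}}},$$ where $\mathcal{S}$ ranges over all sparse collections $\mathcal{S}\subset\mathcal{D}$ with Carleson constant $\Lambda$ and no infinitely increasing chains, and $a,b$ range over all elements of $BMO^{\mathcal{D}}(\mathbb{R}^n)$ with nonzero norms.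
   Context: $\mathcal{D}$ is a fixed dyadic grid on $\mathbb{R}^n$: a collection of cubes with side lengths $2^k$, $k\in\mathbb{Z}$, such that for each fixed $k$ the cubes of side length $2^k$ partition $\mathbb{R}^n$, and $P\cap Q\in\{P,Q,\emptyset\}$ for all $P,Q\in\mathcal{D}$. $\mathcal{S}\subset\mathcal{D}$ has Carleson constant $\Lambda>1$ (is $\Lambda$-Carleson) if $\sum_{P\in\mathcal{S},P\subset Q}|P|\le\Lambda|Q|$ for all $Q\in\mathcal{D}$; it is sparse if it is $\Lambda$-Carleson for some $\Lambda>1$. $\mathcal{S}$ has an infinitely increasing chain if there are $Q_k\in\mathcal{S}$, $k\in\mathbb{N}$, with $Q_k\subsetneq Q_{k+1}$ for all $k$. Haar functions: for an interval $I$, $h_I^0=|I|^{-1/2}(\mathbf{1}_{I_+}-\mathbf{1}_{I_-})$ ($I_\pm$ the right/left halves) and $h_I^1=|I|^{-1/2}\mathbf{1}_I$; for $Q=I_1\times\dots\times I_n\in\mathcal{D}$ and $\epsilon\in\{0,1\}^n$, $h_Q^\epsilon(x)=\prod_kh_{I_k}^{\epsilon_k}(x_k)$, cancellative when $\epsilon\not\equiv1$. A weight is a locally integrable, a.e. positive function; $\langle f\rangle_Q=\frac1{|Q|}\int_Qf\,dx$, $(f,g)=\int fg\,dx$; $L^p(w)$ is $L^p$ of the measure $w\,dx$. With $1/p+1/p'=1$, $w'=w^{1-p'}$, $w\in A_p^{\mathcal{D}}$ means $\sup_{Q\in\mathcal{D}}\langle w\rangle_Q\langle w'\rangle_Q^{p-1}<\infty$.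 $\|b\|_{BMO^{\mathcal{D}}}=\sup_{Q\in\mathcal{D}}\frac1{|Q|}\int_Q|b-\langle b\rangle_Q|\,dx$. $\mathcal{A}_{\mathcal{S}}f=\sum_{Q\in\mathcal{S}}\langle f\rangle_Q\mathbf{1}_Q$ and $\Pi_a^*\Pi_bf=\sum_{Q\in\mathcal{D}}\sum_{\epsilon\not\equiv1}(a,h_Q^\epsilon)(b,h_Q^\epsilon)\langle f\rangle_Q\frac{\mathbf{1}_Q}{|Q|}$, the composition of the paraproducts $\Pi_bf=\sum_{Q,\epsilon\not\equiv1}(b,h_Q^\epsilon)\langle f\rangle_Qh_Q^\epsilon$ and $\Pi_a^*f=\sum_{Q,\epsilon\not\equiv1}(a,h_Q^\epsilon)(f,h_Q^\epsilon)\frac{\mathbf{1}_Q}{|Q|}$. $\|T:X\to Y\|$ is the operator norm. *)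

(* Defs.v *)
From HB Require Import structures.
From mathcomp Require Import all_boot all_order all_algebra.
From mathcomp Require Import all_classical all_reals all_analysis.
From mathcomp Require Import measurable_realfun.

Set Implicit Arguments.
Unset Strict Implicit.
Unset Printing Implicit Defensive.

Import Order.TTheory GRing.Theory Num.Theory.
Import numFieldNormedType.Exports.

Local Open Scope classical_set_scope.
Local Open Scope ring_scope.

(* R^n with its Borel (product) sigma-algebra; the library has no Lebesgue
   measure on it, so leb is built below as an iterated product measure, and
   leb_box gives its value on boxes. *)
Notation Rn R n := (n.-tuple (measurableTypeR R)).

Definition consRn (R : realType) (n : nat)
  (z : measurableTypeR R * Rn R n) : Rn R n.+1 :=
  [the n.+1.-tuple _ of z.1 :: z.2].

Lemma measurable_consRn (R : realType) (n : nat) :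
  measurable_fun [set: measurableTypeR R * Rn R n] (@consRn R n).
Proof. exact: measurable_cons. Qed.

Section leb_step.
Local Open Scope ereal_scope.
Context (R : realType) (n : nat).
Context (mu : {sigma_finite_measure set Rn R n -> \bar R}).

Definition leb_step : set (Rn R n.+1) -> \bar R :=
  pushforward (@lebesgue_measure R \x mu) (@consRn R n).

Let mf := @measurable_consRn R n.

Let leb_step0 : leb_step set0 = 0.
Proof. by rewrite /leb_step /pushforward preimage_set0 measure0. Qed.

Let leb_step_ge0 A : 0 <= leb_step A.
Proof. exact: measure_ge0. Qed.

Let leb_step_sigma_additive : semi_sigma_additive leb_step.
Proof. by apply: measure_semi_sigma_additive. Qed.

HB.instance Definition _ := isMeasure.Build _ _ _ leb_step
  leb_step0 leb_step_ge0 leb_step_sigma_additive.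

Let leb_step_sigma_finite : sigma_finite setT leb_step.
Proof.
have /sigma_finiteP[F [FT ndF Foo]] := sigma_finiteT (@lebesgue_measure R).
have /sigma_finiteP[G [GT ndG Goo]] := sigma_finiteT mu.
have mg : measurable_fun [set: Rn R n.+1] (fun t => thead t : measurableTypeR R).
  exact: measurable_tnth.
exists (fun k => [set t : Rn R n.+1 | F k (thead t) /\ G k [tuple of behead t]]).
  apply/esym/seteqP; split => // t _.
  have [i _ Fi] : (\bigcup_k F k) (thead t) by rewrite -FT.
  have [j _ Gj] : (\bigcup_k G k) [tuple of behead t] by rewrite -GT.
  exists (maxn i j) => //=; split.
    by move: Fi; exact/subsetPset/ndF/leq_maxl.
  by move: Gj; exact/subsetPset/ndG/leq_maxr.
move=> k; have [mF Foo'] := Foo k; have [mG Goo'] := Goo k; split.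
  apply: measurableI; rewrite -[X in measurable X]setTI.
    exact: mg.
  exact: measurable_behead.
rewrite /leb_step /pushforward (_ : _ @^-1` _ = F k `*` G k).
  by rewrite product_measure1E// lte_mul_pinfty// ge0_fin_numE.
have bK z : [tuple of behead (@consRn R n z)] = z.2 by exact/val_inj.
by apply/seteqP; split => -[x t] /=; rewrite bK.
Qed.

HB.instance Definition _ := @Measure_isSigmaFinite.Build _ _ _ leb_step
  leb_step_sigma_finite.

End leb_step.

Fixpoint leb (R : realType) (n : nat) :
    {sigma_finite_measure set Rn R n -> \bar R} :=
  match n with
  | 0 => [the {sigma_finite_measure set _ -> \bar R} of
           @dirac _ (Rn R 0) [tuple] R]
  | m.+1 => [the {sigma_finite_measure set _ -> \bar R} of leb_step (leb R m)]
  end.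

Definition box (R : realType) (n : nat) (I : 'I_n -> set R) : set (Rn R n) :=
  [set x | forall i, I i (tnth x i)].

Lemma measurable_box (R : realType) (n : nat) (I : 'I_n -> set R) :
  (forall i, measurable (I i)) -> measurable (box I).
Proof.
move=> mI; rewrite (_ : box I = \bigcap_(i in [set: 'I_n])
    ((@tnth n (measurableTypeR R) ^~ i) @^-1` I i)).
  apply: fin_bigcap_measurable => // i _.
  rewrite -[X in measurable X]setTI.
  by apply: (@measurable_tnth _ (measurableTypeR R) n i) => //; exact: mI.
by apply/seteqP; split => [x xI i _|x xI i]; [exact: xI|exact: (xI i)].
Qed.

Lemma leb_box (R : realType) (n : nat) (a b : 'I_n -> R) :
  (forall i, a i <= b i) ->
  leb R n (box (fun i => `[a i, b i[%classic)) = (\prod_(i < n) (b i - a i))%:E.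
Proof.
elim: n a b => [|n IHn] a b ab.
  by rewrite big_ord0 /= diracE mem_set//; case.
rewrite big_ord_recl /= /leb_step /pushforward.
rewrite (_ : _ @^-1` _ = `[a ord0, b ord0[%classic `*`
    box (fun i => `[a (lift ord0 i), b (lift ord0 i)[%classic)); last first.
  apply/seteqP; split => [[x t] H|[x t] [H0 H] i].
    split; first exact: (H ord0).
    by move=> i; have := H (lift ord0 i); rewrite /consRn /= tnthS.
  by have [j ->|->//] := unliftP ord0 i; have := H j; rewrite /consRn /= tnthS.
rewrite product_measure1E//; last first.
  by apply: measurable_box => i; exact: measurable_itv.
rewrite IHn// EFinM; congr (_ * _)%E.
have := @lebesgue_measure_itv R `[a ord0, b ord0[; rewrite /= lte_fin => ->.
case: ltP => // ba; rewrite (@le_anti _ _ (a ord0) (b ord0)) ?subrr//.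
by rewrite ab ba.
Qed.

(* Every compact subset of R^n lies in a compact box. *)
Definition loc_integrable (R : realType) (n : nat) (f : Rn R n -> R) : Prop :=
  measurable_fun setT f /\
  forall a b : 'I_n -> R,
    (leb R n).-integrable (box (fun i => `[a i, b i]%classic)) (EFin \o f).

Record weight (R : realType) (n : nat) := Weight {
  weight_fun :> Rn R n -> R ;
  weight_loc_integrable : loc_integrable weight_fun ;
  weight_ae_gt0 : {ae leb R n, forall x, 0 < weight_fun x} }.

(* The measure w dx. *)
Definition wdx (R : realType) (n : nat) (w : weight R n) (A : set (Rn R n)) : \bar R :=
  (\int[leb R n]_(x in A) (w x)%:E)%E.

Section wdx_measure.
Local Open Scope ereal_scope.
Context (R : realType) (n : nat) (w : weight R n).
Local Notation mu := (leb R n).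
Let wE (x : Rn R n) : \bar R := (w x)%:E.

Let mw : measurable_fun setT wE.
Proof. by apply/measurable_EFinP; have [] := weight_loc_integrable w. Qed.

Let ae_pos : ae_eq mu setT wE wE^\+.
Proof.
apply: filterS (weight_ae_gt0 w) => x w0 _.
by rewrite funeposE /wE /=; apply/esym/max_idPl; rewrite lee_fin ltW.
Qed.

Let ae_neg : ae_eq mu setT (cst 0) wE^\-.
Proof.
apply: filterS (weight_ae_gt0 w) => x w0 _.
by rewrite funenegE /wE /=; apply/esym/max_idPr; rewrite lee_fin oppr_le0 ltW.
Qed.

Let wdx0 : wdx w set0 = 0.
Proof. exact: integral_set0. Qed.

Let wdx_ge0 A : 0 <= wdx w A.
Proof.
rewrite /wdx integralE.
suff -> : \int[mu]_(x in A) wE^\- x = 0 by rewrite sube0 integral_ge0.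
apply/eqP; rewrite eq_le integral_ge0// andbT.
have <- : \int[mu]_x wE^\- x = 0.
  rewrite -(ge0_ae_eq_integral _ _ _ _ _ ae_neg)//= ?integral0//.
  exact: measurable_funeneg.
rewrite integral_mkcond !ge0_integralTE//; last first.
  by move=> x; exact: erestrict_ge0.
apply: ge_ereal_sup => _ [h /= hw <-]; apply: ereal_sup_ubound.
exists h => //= x; apply: le_trans (hw x) _.
by rewrite patchE; case: ifP => // _; rewrite funeneg_ge0.
Qed.

Let wdx_sigma_additive : semi_sigma_additive (wdx w).
Proof.
move=> F mF tF mUF.
have wdxE A : measurable A -> wdx w A = \int[mu]_(x in A) wE^\+ x.
  move=> mA; apply: ae_eq_integral => //.
  - exact: measurable_funTS.
  - by apply: measurable_funTS; exact: measurable_funepos.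
  - by apply: filterS ae_pos => x /(_ I).
rewrite wdxE// ge0_integral_bigcup//; last first.
  by apply: measurable_funTS; exact: measurable_funepos.
under [X in X @ _ --> _]eq_fun do under eq_bigr do rewrite wdxE//.
apply: is_cvg_nneseries => k _ _; exact: integral_ge0.
Qed.

HB.instance Definition _ := isMeasure.Build _ _ _ (wdx w)
  wdx0 wdx_ge0 wdx_sigma_additive.
End wdx_measure.

Section dyadic.
Local Open Scope ereal_scope.
Context (R : realType) (n : nat).
Local Notation mu := (leb R n).

(* (a, k) encodes the half-open cube of lower corner a and side length 2 ^ k;
   for 0 < n the encoding is injective. *)
Definition cube : Type := (Rn R n * int)%type.

Definition side (Q : cube) : R := (2 ^ Q.2)%R.

Definition cube_set (Q : cube) : set (Rn R n) :=
  box (fun i => `[(tnth Q.1 i : R), (tnth Q.1 i + side Q)%R[%classic).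

Definition vol (Q : cube) : \bar R := mu (cube_set Q).

Lemma volE (Q : cube) : vol Q = (side Q ^+ n)%:E.
Proof.
rewrite /vol /cube_set leb_box; last first.
  by move=> i; rewrite lerDl ltW// exprz_gt0.
congr EFin; under eq_bigr do rewrite addrAC subrr add0r.
by rewrite prodr_const card_ord.
Qed.

Definition dyadic_grid (D : set cube) : Prop :=
  (forall k : int, partition [set Q | D Q /\ Q.2 = k] cube_set setT) /\
  (forall P Q, D P -> D Q ->
     [\/ cube_set P `&` cube_set Q = cube_set P,
         cube_set P `&` cube_set Q = cube_set Q |
         cube_set P `&` cube_set Q = set0]).

Definition carleson (D : set cube) (Lambda : R) (S : set cube) : Prop :=
  forall Q, D Q ->
    \esum_(P in [set P | S P /\ cube_set P `<=` cube_set Q]) vol P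
      <= Lambda%:E * vol Q.

Definition infinite_increasing_chain (S : set cube) : Prop :=
  exists q : nat -> cube, (forall k, S (q k)) /\
    (forall k, cube_set (q k) `<` cube_set (q k.+1)).

(* <f>_Q *)
Definition avg (f : Rn R n -> \bar R) (Q : cube) : \bar R :=
  (\int[mu]_(x in cube_set Q) f x) / vol Q.

(* h_I^1 (e = true) and h_I^0 (e = false) for I = [a, a + l[ *)
Definition haar1 (e : bool) (a l t : R) : R :=
  (l `^ (- 2^-1) *
   (if e then \1_(`[a, a + l[%classic) t
    else \1_(`[a + l / 2, a + l[%classic) t -
         \1_(`[a, a + l / 2[%classic) t))%R.

Definition haar (Q : cube) (eps : {ffun 'I_n -> bool}) (x : Rn R n) : R :=
  (\prod_(i < n) haar1 (eps i) (tnth Q.1 i) (side Q) (tnth x i))%R.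

(* (b, h_Q^eps) *)
Definition haar_coef (b : Rn R n -> R) (Q : cube) (eps : {ffun 'I_n -> bool})
    : \bar R :=
  \int[mu]_x (b x * haar Q eps x)%:E.

Definition bmo_norm (D : set cube) (b : Rn R n -> R) : \bar R :=
  ereal_sup [set avg (fun x => `|(b x)%:E - avg (EFin \o b) Q|) Q | Q in D].

Definition bmo (D : set cube) (b : Rn R n -> R) : Prop :=
  loc_integrable b /\ bmo_norm D b < +oo.

Definition Ap (D : set cube) (p : R) (w : weight R n) : Prop :=
  let p' := fine (hoelder_conjugate p%:E) in
  let w' := fun x => (w x `^ (1 - p'))%R in
  ereal_sup [set avg (EFin \o w) Q * (avg (EFin \o w') Q) `^ (p - 1) | Q in D]
    < +oo.

(* Unordered sum of a signed family. When the family is not absolutely summable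
   the value is infinite (as +oo - +oo = -oo), so that the norms below are
   infinite as soon as this happens on a set of positive measure. *)
Definition sum_over (I : choiceType) (D : set I) (u : I -> \bar R) : \bar R :=
  \esum_(i in D) u^\+ i - \esum_(i in D) u^\- i.

Definition sparse_op (S : set cube) (f : Rn R n -> R) (x : Rn R n) : \bar R :=
  sum_over S (fun Q => avg (EFin \o f) Q * (\1_(cube_set Q) x)%:E).

Definition paraproduct_comp (D : set cube) (a b f : Rn R n -> R) (x : Rn R n)
    : \bar R :=
  sum_over D (fun Q =>
    \sum_(eps : {ffun 'I_n -> bool} | eps != [ffun=> true])
      haar_coef a Q eps * haar_coef b Q eps * avg (EFin \o f) Q *
      ((\1_(cube_set Q) x)%:E / vol Q)).

(* Norm of T on L^p(nu), as a supremum over the unit ball. *)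
Definition opnorm (nu : {measure set Rn R n -> \bar R}) (p : R)
    (T : (Rn R n -> R) -> (Rn R n -> \bar R)) : \bar R :=
  ereal_sup [set 'N[nu]_p%:E[T f] | f in
    [set f | f \in Lfun nu p%:E /\ 'N[nu]_p%:E[EFin \o f] <= 1]].

Definition sup_sparse (D : set cube) (Lambda p : R) (w : weight R n) : \bar R :=
  ereal_sup [set opnorm (wdx w) p (sparse_op S) | S in
    [set S | [/\ S `<=` D, carleson D Lambda S &
                 ~ infinite_increasing_chain S]]].

Definition sup_paraproduct (D : set cube) (p : R) (w : weight R n) : \bar R :=
  ereal_sup [set opnorm (wdx w) p (paraproduct_comp D ab.1 ab.2) /
                 (bmo_norm D ab.1 * bmo_norm D ab.2) | ab in
    [set ab : (Rn R n -> R) * (Rn R n -> R) |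
      [/\ bmo D ab.1, bmo D ab.2, bmo_norm D ab.1 != 0 & bmo_norm D ab.2 != 0]]].

End dyadic.

(* Main.v *)
Require Import Defs.
From HB Require Import structures.
From mathcomp Require Import all_boot all_order all_algebra.
From mathcomp Require Import all_classical all_reals all_analysis.
From mathcomp Require Import measurable_realfun.
From mathcomp Require Import ring lra zify.

(** Both operators are superpositions of the averaging operators
    [f |-> <f>_Q 1_Q]: with coefficients 1 on the cubes of [S] for [A_S], and with
    the coefficients [sum_eps (a, h_Q^eps) (b, h_Q^eps) / |Q|] for [Pi_a^* Pi_b].
    Monotone convergence ([Lnorm_esum]) reduces both inequalities to finite
    families of cubes.

    Sparse operators are paraproduct compositions. For a finite [Lambda]-Carleson
    family [S] let [a] be the sum over [S] of [|Q|^(1/2) h_Q^0]. By orthogonality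
    of the Haar functions the coefficients of [Pi_a^* Pi_a] are 1 on [S] and 0
    elsewhere, so that [Pi_a^* Pi_a = A_S] ([paraproduct_haar0_sum]). On a cube
    [T], [a] differs from its mean only by the terms with [Q] inside [T], and the
    Carleson condition bounds the norm of [a] by [Lambda] ([haar0_sum_bmo]). This
    gives the constant [C = Lambda ^ 2].

    Paraproduct compositions are dominated by sparse operators. When [a] and [b]
    have norm 1, the coefficients are dominated by the mean squares of the
    martingale differences of [a] and [b] ([haar_mean_sqr]), and these form a
    Carleson sequence, by a stopping time argument that replaces the
    John-Nirenberg inequality ([variation_carleson]). A second stopping time
    argument turns such a sum into a sparse operator ([sparse_domination]): below
    a selected cube, the next ones are the maximal cubes on which the average of
    [|f|] has grown by a factor [K], or the coefficients met on the way have a sum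
    above [M]. Taking [K] and [M] large makes the selected cubes Carleson with the
    prescribed constant [Lambda], and the cubes between two selected ones
    contribute at most [K * M] times the average of [|f|] over the upper one. The
    selected family depends on [f], which does no harm to operator norms. *)

Import Order.TTheory GRing.Theory Num.Theory.
Import numFieldNormedType.Exports.
Local Open Scope classical_set_scope.
Local Open Scope ring_scope.

Set Implicit Arguments.
Unset Strict Implicit.
Unset Printing Implicit Defensive.

(** * Cubes, their children, and the grid *)

Section cubes.
Context (R : realType) (n : nat).
Implicit Types (P Q : cube R n) (x y : Rn R n) (c : {ffun 'I_n -> bool}).

Lemma side_gt0 Q : 0 < side Q.
Proof. by rewrite exprz_gt0. Qed.

Lemma in_cubeP Q x : cube_set Q x <->
  forall i, tnth Q.1 i <= tnth x i :> R /\ tnth x i < tnth Q.1 i + side Q :> R.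
Proof.
by split=> H i; move: (H i); rewrite /= in_itv /= => /andP.
Qed.

Lemma corner_in Q : cube_set Q Q.1.
Proof. by apply/in_cubeP => i; rewrite lexx ltrDl side_gt0. Qed.

Lemma measurable_cube Q : measurable (cube_set Q).
Proof. by apply: measurable_box => i; exact: measurable_itv. Qed.

Definition child Q c : cube R n :=
  ([tuple (tnth Q.1 i : R) + (c i)%:R * (side Q / 2) | i < n] : Rn R n,
   Q.2 - 1).

(** The half of [Q] that contains the point [x], in each coordinate: it tells which
    child of [Q] contains [x] when [x] is in [Q]. *)
Definition octant Q x : {ffun 'I_n -> bool} :=
  [ffun i => (tnth Q.1 i : R) + side Q / 2 <= (tnth x i : R)].

Lemma side_child Q c : side (child Q c) = side Q / 2.
Proof. by rewrite /side /= expfzDr. Qed.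

Lemma tnth_child Q c i :
  tnth (child Q c).1 i = tnth Q.1 i + (c i)%:R * (side Q / 2) :> R.
Proof. by rewrite tnth_mktuple. Qed.

(** Disjointness of the children, their inclusion in [Q] and the fact that they
    cover [Q] are all read off this characterization. *)
Lemma in_childP Q c x :
  cube_set (child Q c) x <-> cube_set Q x /\ octant Q x = c.
Proof.
have s0 := side_gt0 Q; rewrite !in_cubeP; split=> [H|[H <-] i].
  split=> [i|].
    have := H i; rewrite tnth_child side_child; case: (c i) => /= -[]; lra.
  apply/ffunP => i; have := H i; rewrite tnth_child side_child ffunE.
  case: (c i) => /= -[] h1 h2; first by apply/idP; lra.
  by apply/negbTE; rewrite -ltNge; lra.
have := H i; rewrite tnth_child side_child ffunE.
case: (lerP (tnth Q.1 i + side Q / 2 : R)) => /= h []; lra.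
Qed.

Lemma child_sub Q c : cube_set (child Q c) `<=` cube_set Q.
Proof. by move=> x /in_childP[]. Qed.

Lemma cube_children Q :
  cube_set Q = \big[setU/set0]_(c : {ffun 'I_n -> bool}) cube_set (child Q c).
Proof.
apply/seteqP; split=> x; rewrite -bigcup_seq.
  by move=> Qx; exists (octant Q x) => /=; [rewrite mem_index_enum|exact/in_childP].
by move=> [c _]; exact: child_sub.
Qed.

Lemma trivIset_children Q : trivIset setT (fun c => cube_set (child Q c)).
Proof. by move=> c d _ _ [x []] /in_childP[_ <-] /in_childP[]. Qed.

Definition volr Q : R := side Q ^+ n.

Lemma volr_gt0 Q : 0 < volr Q.
Proof. by rewrite exprn_gt0// side_gt0. Qed.

Lemma volrE Q : vol Q = (volr Q)%:E. Proof. exact: volE. Qed.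

Lemma volr_child Q c : volr (child Q c) = volr Q / 2 ^+ n.
Proof. by rewrite /volr side_child exprMn exprVn. Qed.

Lemma sum_bits_cst (r : R) : \sum_(c : {ffun 'I_n -> bool}) r = r * 2 ^+ n.
Proof. by rewrite sumr_const card_ffun card_bool card_ord -[LHS]mulr_natr natrX. Qed.

Lemma sum_volr_child Q : \sum_c volr (child Q c) = volr Q.
Proof.
by under eq_bigr do rewrite volr_child; rewrite sum_bits_cst divfK// expf_neq0.
Qed.

Definition upd x (i : 'I_n) (v : R) : Rn R n :=
  [tuple if j == i then v else (tnth x j : R) | j < n].

Lemma tnth_upd x i v j :
  tnth (upd x i v) j = if j == i then v else tnth x j :> R.
Proof. by rewrite tnth_mktuple. Qed.

Hypothesis n_gt0 : (0 < n)%N.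

Lemma volr_le P Q : (volr P <= volr Q) = (P.2 <= Q.2).
Proof.
rewrite /volr (ler_pXn2r n_gt0) ?nnegrE; try exact: ltW (side_gt0 _).
by rewrite /side ler_eXz2l// ltr1n.
Qed.

(** Comparing volumes; in dimension 0 all cubes would be the same point. *)
Lemma sub_level P Q : cube_set P `<=` cube_set Q -> P.2 <= Q.2.
Proof.
move=> PQ; rewrite -volr_le -lee_fin -!volrE /vol.
by apply: le_measure => //; rewrite inE; exact: measurable_cube.
Qed.

Section grid.
Variables (D : set (cube R n)).
Hypothesis hD : dyadic_grid D.

Lemma grid_cover k x : exists Q, [/\ D Q, Q.2 = k & cube_set Q x].
Proof.
have [/(_ k)[+ _ _] _] := hD => /seteqP[_ /(_ x I)].
by move=> [Q [DQ Qk] Qx]; exists Q.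
Qed.

Lemma grid_inj P Q x : D P -> D Q -> P.2 = Q.2 -> cube_set P x ->
  cube_set Q x -> P = Q.
Proof.
move=> DP DQ PQ Px Qx; have [/(_ Q.2)[_ + _] _] := hD.
by apply; [split|split|exists x].
Qed.

Lemma grid_nested P Q x : D P -> D Q -> P.2 <= Q.2 -> cube_set P x ->
  cube_set Q x -> cube_set P `<=` cube_set Q.
Proof.
move=> DP DQ PQ Px Qx; have [_ /(_ P Q DP DQ)] := hD; case=> H.
- by rewrite -H; exact: subIsetr.
- have QP : cube_set Q `<=` cube_set P by rewrite -H; exact: subIsetl.
  have PQ2 : P.2 = Q.2 by apply/le_anti; rewrite PQ sub_level.
  by rewrite (grid_inj DP DQ PQ2 Px Qx).
- by have : set0 x by rewrite -H; split.
Qed.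

(** The only cubes of half the side that the grid can contain inside [Q] are the
    children of [Q]. On a line parallel to an axis, the cubes of that level
    inside [Q] cut the half-open edge of [Q] into half-open intervals of half
    its length; the one that starts at the left end leaves room for exactly one
    other, which must start at the midpoint. So the corner of every such cube is
    that of [Q], moved by 0 or half the side in each coordinate. *)
Lemma grid_octant Q P x : D Q -> D P -> P.2 = Q.2 - 1 ->
  cube_set P x -> cube_set Q x -> P = child Q (octant Q x).
Proof.
move=> DQ DP Pk Px Qx; have s0 := side_gt0 Q.
have sP (T : cube R n) : T.2 = Q.2 - 1 -> side T = side Q / 2.
  by move=> e; rewrite /side e expfzDr.
have sub T y : D T -> T.2 = Q.2 - 1 -> cube_set T y -> cube_set Q y ->
    cube_set T `<=` cube_set Q.
  by move=> DT Tk; apply: grid_nested => //; rewrite Tk gerBl.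
suff H i : tnth P.1 i = tnth Q.1 i + (octant Q x i)%:R * (side Q / 2) :> R.
  rewrite /child -Pk [LHS]surjective_pairing; congr pair; apply: eq_from_tnth => i.
  by rewrite tnth_mktuple H.
have Qu v : tnth Q.1 i <= v -> v < tnth Q.1 i + side Q -> cube_set Q (upd x i v).
  move=> v0 v1; apply/in_cubeP => j; rewrite tnth_upd.
  by case: eqP => [->//|_]; move/in_cubeP: Qx.
(* T is the leftmost cube inside Q on the line through x parallel to the i-th axis, and
   T' (below) the one that contains the midpoint of its part in Q. *)
have [T [DT Tk Tx]] := grid_cover (Q.2 - 1) (upd x i (tnth Q.1 i : R)).
have Qa : cube_set Q (upd x i (tnth Q.1 i : R)) by apply: Qu => //; lra.
have TQ := sub T _ DT Tk Tx Qa.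
have Ti : tnth T.1 i = tnth Q.1 i :> R.
  apply/eqP; rewrite eq_le; apply/andP; split.
    by move/in_cubeP: Tx => /(_ i)[+ _]; rewrite tnth_upd eqxx.
  by have /in_cubeP/(_ i)[] := TQ _ (corner_in T).
have Tu v : tnth Q.1 i <= v -> v < tnth Q.1 i + side Q / 2 -> cube_set T (upd x i v).
  move=> v0 v1; apply/in_cubeP => j; rewrite tnth_upd sP//.
  case: eqP => [->|/eqP ji]; first by rewrite Ti; split=> //; lra.
  by move/in_cubeP : Tx => /(_ j); rewrite tnth_upd (negbTE ji) sP.
have xE : x = upd x i (tnth x i : R).
  by apply: eq_from_tnth => j; rewrite tnth_mktuple; case: eqP => [->|].
have [Qxi1 Qxi2] : tnth Q.1 i <= tnth x i :> R /\ tnth x i < tnth Q.1 i + side Q :> R.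
  by move/in_cubeP : Qx.
rewrite ffunE; case: (lerP (tnth Q.1 i + side Q / 2 : R)) => /= hx; last first.
  have -> : P = T by apply: (grid_inj (x := x)) => //; [rewrite Pk|rewrite xE; apply: Tu].
  by rewrite Ti; lra.
have [T' [DT' T'k T'x]] := grid_cover (Q.2 - 1) (upd x i (tnth Q.1 i + side Q / 2 : R)).
have T'Q : cube_set T' `<=` cube_set Q.
  by apply: (sub T' _ DT' T'k T'x); apply: Qu; lra.
have T'i1 : tnth T'.1 i <= tnth Q.1 i + side Q / 2 :> R.
  by move/in_cubeP: T'x => /(_ i)[+ _]; rewrite tnth_upd eqxx.
have T'i2 : tnth Q.1 i <= tnth T'.1 i :> R.
  by have /in_cubeP/(_ i)[] := T'Q _ (corner_in T').
have T'u v : tnth T'.1 i <= v -> v < tnth T'.1 i + side Q / 2 -> cube_set T' (upd x i v).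
  move=> v0 v1; apply/in_cubeP => j; rewrite tnth_upd sP//.
  case: eqP => [->|/eqP ji]; first by split=> //; lra.
  by move/in_cubeP : T'x => /(_ j); rewrite tnth_upd (negbTE ji) sP.
have T'i : tnth T'.1 i = tnth Q.1 i + side Q / 2 :> R.
  apply/eqP; rewrite eq_le T'i1 /= leNgt; apply/negP => lt.
  have E : T = T'.
    apply: (grid_inj (x := upd x i (tnth T'.1 i : R))) => //.
    - by rewrite Tk.
    - exact: Tu.
    - by apply: T'u => //; lra.
  move: T'x => /in_cubeP /(_ i)[_]; rewrite -E (sP T)// tnth_upd eqxx Ti; lra.
have -> : P = T'.
  apply: (grid_inj (x := x)) => //; [by rewrite Pk|rewrite xE; apply: T'u]; lra.
by rewrite T'i mul1r.
Qed.

Lemma grid_child Q c : D Q -> D (child Q c).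
Proof.
move=> DQ; have /in_childP[Qx <-] := corner_in (child Q c).
have [P [DP Pk Px]] := grid_cover (Q.2 - 1) (child Q c).1.
by rewrite -(grid_octant DQ DP Pk Px Qx).
Qed.

Lemma grid_ancestor P k : D P -> P.2 <= k ->
  exists Q, [/\ D Q, Q.2 = k & cube_set P `<=` cube_set Q].
Proof.
move=> DP Pk; have [Q [DQ Qk Qx]] := grid_cover k P.1; exists Q; split=> //.
by apply: (grid_nested (x := P.1)) => //; [rewrite Qk|exact: corner_in].
Qed.

Lemma grid_sub_child P Q x : D P -> D Q -> P.2 < Q.2 -> cube_set P x ->
  cube_set Q x -> cube_set P `<=` cube_set (child Q (octant Q x)).
Proof.
move=> DP DQ PQ Px Qx; apply: (grid_nested (x := x)) => //.
- exact: grid_child.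
- by rewrite /=; lia.
- exact/in_childP.
Qed.

End grid.
End cubes.

(** * Trees of descendants *)

Lemma ler_sum_subseq (R : numDomainType) (T : eqType) (F : T -> R) (s t : seq T) :
  (forall x, 0 <= F x) -> uniq s -> {subset s <= t} ->
  \sum_(x <- s) F x <= \sum_(x <- t) F x.
Proof.
move=> F0; elim: s t => [|x s IH] t /=.
  by move=> _ _; rewrite big_nil sumr_ge0.
move=> /andP[xs us] st; rewrite big_cons [leRHS](big_rem x) ?st ?mem_head//=.
rewrite lerD2l; apply: IH => // y ys.
have yx : y != x by apply: contraNneq xs => <-.
have := st y; rewrite inE ys orbT => /(_ isT).
by rewrite (perm_mem (perm_to_rem (st x (mem_head _ _)))) inE (negbTE yx).
Qed.

Lemma uniq_flatten_disjoint (T : eqType) (I : eqType) (r : seq I) (S : I -> seq T) :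
  uniq r -> (forall i, i \in r -> uniq (S i)) ->
  (forall i j x, i \in r -> j \in r -> x \in S i -> x \in S j -> i = j) ->
  uniq (flatten [seq S i | i <- r]).
Proof.
elim: r => [//|i r IH] /= /andP[ir ur] uS dS.
rewrite cat_uniq uS ?mem_head//= IH//; last first.
- by move=> a b x ar br; apply: dS; rewrite inE ?ar ?br orbT.
- by move=> j jr; rewrite uS// inE jr orbT.
rewrite andbT; apply/hasPn => x /flattenP[_ /mapP[j jr ->] xj].
apply/negP => xi; have ij : i = j.
  by apply: (dS i j x); rewrite ?mem_head// inE jr orbT.
by rewrite ij jr in ir.
Qed.

Lemma sqr_le (R : realDomainType) (u v : R) : `|u| <= v -> u ^+ 2 <= v ^+ 2.
Proof.
move=> uv; rewrite -(real_normK (num_real u)) ler_sqr ?nnegrE//.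
exact: le_trans uv.
Qed.

Section trees.
Context (R : realType) (n : nat).
Implicit Types (P Q : cube R n) (x : Rn R n) (c : {ffun 'I_n -> bool}).

(** The descendants of [Q] of the first [N] generations, [Q] included. Finite
    depth keeps all the inductions below structural. *)
Fixpoint tree N Q : seq (cube R n) :=
  if N is N'.+1 then
    Q :: flatten [seq tree N' (child Q c) | c <- index_enum {ffun 'I_n -> bool}]
  else [::].

Lemma sum_tree N Q (F : cube R n -> R) : \sum_(P <- tree N.+1 Q) F P =
  F Q + \sum_c \sum_(P <- tree N (child Q c)) F P.
Proof. by rewrite /= big_cons big_flatten big_map. Qed.

Variables (D : set (cube R n)).
Hypothesis n_gt0 : (0 < n)%N.
Hypothesis hD : dyadic_grid D.

Let dc Q c : D Q -> D (child Q c). Proof. exact: grid_child. Qed.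

Lemma tree_grid N Q P : D Q -> P \in tree N Q ->
  [/\ D P, P.2 <= Q.2 & cube_set P `<=` cube_set Q].
Proof.
elim: N Q => [//|N IH] Q DQ /=.
rewrite inE => /orP[/eqP ->|/flattenP[_ /mapP[c _ ->] /IH]]; first by split.
move=> /(_ (dc _ DQ))[DP PQ /subset_trans-/(_ _ (@child_sub _ _ _ _)) ?].
by split=> //; apply: le_trans PQ _; rewrite /= gerBl.
Qed.

Lemma mem_tree N P Q : D P -> D Q -> cube_set P `<=` cube_set Q ->
  Q.2 - P.2 < N%:Z -> P \in tree N Q.
Proof.
elim: N Q => [|N IH] Q DP DQ PQ PQN.
  by exfalso; move: (sub_level n_gt0 PQ) PQN; lia.
have Px := corner_in P; have Qx := PQ _ Px.
have := sub_level n_gt0 PQ; rewrite le_eqVlt => /orP[/eqP e|lt] /=.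
  by rewrite (grid_inj hD DP DQ e Px Qx) mem_head.
rewrite inE; apply/orP; right; apply/flattenP.
exists (tree N (child Q (octant Q P.1))).
  by apply/mapP; exists (octant Q P.1) => //; rewrite mem_index_enum.
apply: IH => //; first exact: dc.
  exact: (grid_sub_child n_gt0 hD).
by move: PQN => /=; lia.
Qed.

(** Satisfied by the averages over cubes of a fixed function. *)
Definition mean_value (F : cube R n -> R) :=
  forall Q, D Q -> \sum_c F (child Q c) * volr (child Q c) = F Q * volr Q.

Definition tree_carleson (alpha : cube R n -> R) (A : R) :=
  forall N Q, D Q -> \sum_(P <- tree N Q) alpha P * volr P <= A * volr Q.

Lemma mean_value_child F Q c : mean_value F -> (forall P, 0 <= F P) -> D Q ->
  F (child Q c) <= 2 ^+ n * F Q.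
Proof.
move=> mF F0 DQ; have := mF _ DQ; rewrite (bigD1 c)//= volr_child => H.
have vQ := volr_gt0 Q.
have : F (child Q c) * (volr Q / 2 ^+ n) <= F Q * volr Q.
  rewrite -H lerDl sumr_ge0// => d _.
  by rewrite mulr_ge0// ltW// volr_gt0.
rewrite mulrA ler_pdivrMr ?exprn_gt0// -mulrA [volr Q * _]mulrC mulrA.
by rewrite ler_pM2r// mulrC.
Qed.

(** * Carleson condition for the squared martingale differences *)

Section john_nirenberg.

(** The mean over [Q] of the square of the first martingale difference of the
    function whose averages are the values of [b]. *)
Definition variation (b : cube R n -> R) Q : R :=
  \sum_c (b (child Q c) - b Q) ^+ 2 / 2 ^+ n.

(** Orthogonality of martingale differences: summed over the cubes of a tree,
    the terms [(b Q - u) ^+ 2] cancel except at the root and at the leaves. *)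
Lemma variation_telescope b Q u : mean_value b -> D Q ->
  \sum_c (b (child Q c) - u) ^+ 2 * volr (child Q c) =
  variation b Q * volr Q + (b Q - u) ^+ 2 * volr Q.
Proof.
move=> mb DQ.
transitivity (\sum_c ((b (child Q c) - b Q) ^+ 2 / 2 ^+ n * volr Q +
   (2 * (b Q - u) * (b (child Q c) * volr (child Q c)) +
     ((b Q - u) ^+ 2 - 2 * (b Q - u) * b Q) * volr (child Q c)))).
  by apply: eq_bigr => c _; rewrite volr_child; ring.
rewrite big_split /= -mulr_suml big_split /= -!mulr_sumr mb// sum_volr_child.
congr (_ + _); ring.
Qed.

(** The consequence of the John-Nirenberg inequality that is needed: bounded
    mean oscillation, in the sense of [L^1], controls the squares of the
    martingale differences. The number [osc Q0 Q] stands for the average over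
    [Q] of [|b - b Q0|].

    Fix [Q0] and stop at the maximal cubes where [osc Q0] exceeds [2 * B].
    Before stopping, [b - b Q0] is bounded by [2 ^+ n * (2 * B)] even on the
    children, so that the telescoping sum is bounded by [4 * 4 ^+ n * B ^+ 2]
    times the volume. At a stopping cube the bound with fewer generations
    applies, and the stopping cubes fill at most half of [Q0]. The estimate
    [main] records both contributions at once: its last term pays for the
    stopping cubes, since [osc Q0 Q * volr Q] is additive over children. *)
Lemma variation_carleson (b : cube R n -> R) (osc : cube R n -> cube R n -> R)
    (B : R) :
  0 < B -> mean_value b -> (forall Q0, D Q0 -> mean_value (osc Q0)) ->
  (forall Q0 Q, 0 <= osc Q0 Q) ->
  (forall Q0 Q, D Q0 -> D Q -> `|b Q - b Q0| <= osc Q0 Q) ->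
  (forall Q, D Q -> osc Q Q <= B) ->
  tree_carleson (variation b) (8 * 4 ^+ n * B ^+ 2).
Proof.
move=> B0 mb mosc osc0 bosc oscB N.
have E4 : (4 : R) ^+ n = (2 ^+ n) ^+ 2 by rewrite -exprM mulnC exprM; congr (_ ^+ n); ring.
have p1 : (1 : R) <= 2 ^+ n by rewrite exprn_ege1// ler1n.
elim/ltn_ind: N => N IHN Q0 DQ0.
have [v0 o0] := (volr_gt0 Q0, oscB _ DQ0).
have u0 : 0 < 4 * 4 ^+ n * B by rewrite !mulr_gt0// exprn_gt0.
have main m : (m <= N)%N -> forall Q, D Q -> osc Q0 Q <= 2 * B ->
    \sum_(P <- tree m Q) variation b P * volr P + (b Q - b Q0) ^+ 2 * volr Q
    <= 4 * 4 ^+ n * B ^+ 2 * volr Q + 4 * 4 ^+ n * B * (osc Q0 Q * volr Q).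
  elim: m => [_|m IHm mN] Q DQ good; have vQ := volr_gt0 Q.
    have h : (b Q - b Q0) ^+ 2 <= 4 * 4 ^+ n * B ^+ 2.
      have -> : 4 * 4 ^+ n * B ^+ 2 = (2 ^+ n * (2 * B)) ^+ 2 by rewrite E4; ring.
      apply: sqr_le; apply: le_trans (bosc _ _ DQ0 DQ) _.
      by apply: le_trans good _; rewrite ler_peMl// mulr_ge0// ltW.
    rewrite big_nil add0r (le_trans (ler_wpM2r (ltW vQ) h))// lerDl.
    exact: mulr_ge0 (ltW u0) (mulr_ge0 (osc0 _ _) (ltW vQ)).
  rewrite sum_tree addrAC -variation_telescope// -big_split /=.
  rewrite -(mosc _ DQ0 _ DQ) -(sum_volr_child Q) !mulr_sumr -big_split /=.
  apply: ler_sum => c _; rewrite addrC; have vc := volr_gt0 (child Q c).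
  (* gc: the stopping time has not come at this child; bc: it has *)
  have [gc|bc] := lerP (osc Q0 (child Q c)) (2 * B).
    by apply: IHm => //; [exact: ltnW|exact: dc].
  rewrite addrC; apply: lerD.
    rewrite ler_pM2r//.
    have -> : 4 * 4 ^+ n * B ^+ 2 = (2 ^+ n * (2 * B)) ^+ 2 by rewrite E4; ring.
    apply: sqr_le; apply: le_trans (bosc _ _ DQ0 (dc c DQ)) _.
    apply: le_trans (mean_value_child c (mosc _ DQ0) (osc0 _) DQ) _.
    by rewrite ler_pM2l// exprn_gt0.
  apply: le_trans (IHN m mN _ (dc c DQ)) _.
  rewrite mulrA ler_pM2r//.
  have -> : 8 * 4 ^+ n * B ^+ 2 = 4 * 4 ^+ n * B * (2 * B) by ring.
  by rewrite ler_pM2l// ltW.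
have /(_ _ DQ0) := main N (leqnn N); rewrite subrr expr0n /= mul0r addr0.
move=> /(_ ltac:(lra)) /le_trans; apply.
rewrite mulrA -mulrDl ler_pM2r//.
by have := ler_wpM2l (ltW u0) o0; rewrite expr2; lra.
Qed.

End john_nirenberg.

(** * Sparse domination by stopping times *)

Section sparse_domination.
Variables (alpha F : cube R n -> R) (A K M Lambda : R).
Hypothesis alpha0 : forall Q, 0 <= alpha Q.
Hypothesis F0 : forall Q, 0 <= F Q.
Hypothesis mF : mean_value F.
Hypothesis alphaA : tree_carleson alpha A.
Hypothesis K1 : 1 <= K.
Hypothesis A0 : 0 <= A.
Hypothesis AM : A <= M.
Hypothesis M0 : 0 < M.
Hypothesis L1 : 1 < Lambda.
Hypothesis KM : 1 / K + A / M <= (Lambda - 1) / Lambda.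

(** Here [F Q] stands for the average over [Q] of a nonnegative function [f].
    Descending the tree below a stopping cube, [t] is the average of [f] over
    that cube and [s] is the sum of [alpha] over the cubes met since then. A
    new stopping cube is declared when the average of [f] has grown by a factor
    [K], or when the sum would exceed [M]. *)
Definition stops t s Q : bool := (K * t < F Q) || (M < s + alpha Q).

(** The stopping cubes among the first [N] generations below [Q], when [Q] is
    reached in the state [(t, s)]. *)
Fixpoint sel N Q (t s : R) : seq (cube R n) :=
  if N is N'.+1 then
    let: (top, t', s') := if stops t s Q then ([:: Q], F Q, alpha Q)
                        else ([::], t, s + alpha Q) in
    top ++ flatten [seq sel N' (child Q c) t' s' | c <- index_enum {ffun 'I_n -> bool}]
  else [::].

Lemma alpha_le Q : D Q -> alpha Q <= A.
Proof.
move=> DQ; have := @alphaA 1 _ DQ; rewrite sum_tree /= big1 => [|c _].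
  by rewrite addr0 ler_pM2r// volr_gt0.
by rewrite big_nil.
Qed.

Lemma sum_sel N Q t s (G : cube R n -> R) (p : pred (cube R n)) :
  \sum_(P <- sel N.+1 Q t s | p P) G P =
  if stops t s Q
  then (if p Q then G Q else 0) +
    \sum_c \sum_(P <- sel N (child Q c) (F Q) (alpha Q) | p P) G P
  else \sum_c \sum_(P <- sel N (child Q c) t (s + alpha Q) | p P) G P.
Proof.
by rewrite /=; case: ifP => _; rewrite big_cat /= ?big_cons ?big_nil big_flatten
  big_map; [case: ifP; rewrite ?addr0|rewrite add0r].
Qed.

Lemma sel_tree N Q t s : {subset sel N Q t s <= tree N Q}.
Proof.
elim: N Q t s => [//|N IH] Q t s P /=.
have sub t' s' :
    P \in flatten [seq sel N (child Q c) t' s' | c <- index_enum {ffun 'I_n -> bool}] ->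
    P \in flatten [seq tree N (child Q c) | c <- index_enum {ffun 'I_n -> bool}].
  move=> /flattenP[_ /mapP[c ci ->] /IH Pc]; apply/flattenP.
  by exists (tree N (child Q c)) => //; apply/mapP; exists c.
case: ifP => _ /=; last by move=> /sub h; rewrite inE h orbT.
by rewrite !inE => /orP[->//|/sub ->]; rewrite orbT.
Qed.

Lemma sel_grid N Q t s P : D Q -> P \in sel N Q t s ->
  [/\ D P, P.2 <= Q.2 & cube_set P `<=` cube_set Q].
Proof. by move=> DQ /sel_tree; exact: tree_grid. Qed.

Lemma uniq_sel N Q t s : D Q -> uniq (sel N Q t s).
Proof.
elim: N Q t s => [//|N IH] Q t s DQ.
have uf t' s' :
    uniq (flatten [seq sel N (child Q c) t' s' | c <- index_enum {ffun 'I_n -> bool}]).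
  apply: uniq_flatten_disjoint => [|c _|c d P _ _ Pc Pd].
  - exact: index_enum_uniq.
  - exact/IH/dc.
  - have [_ _ /(_ _ (corner_in P))/in_childP[_ <-]] := sel_grid (dc c DQ) Pc.
    by have [_ _ /(_ _ (corner_in P))/in_childP[_ <-]] := sel_grid (dc d DQ) Pd.
rewrite /=; case: ifP => _ //=; rewrite uf andbT.
apply/negP => /flattenP[_ /mapP[c _ ->] /(sel_grid (dc c DQ))[_ h _]].
by have : Q.2 <= Q.2 - 1 by []; rewrite leNgt gtrBl ltr01.
Qed.

(** By induction on the depth, the two bounds feeding each other. Descending,
    the second bound is additive over children, and at a cube where the
    stopping rule applies it is at least [Lambda * volr Q], so it reduces to the
    first one. The first bound at a stopping cube is the second one for its
    children in the fresh state: the stopping cubes strictly below fill at most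
    [Lambda * (1 / K + A / M) * volr Q], which leaves room for [Q] itself.

    The condition relating [t = 0] and [F Q] is what makes the quotient by
    [K * t] meaningful, as division by 0 gives 0: below a cube where [f]
    vanishes the averages never trigger the stopping rule. *)
Lemma sel_volume N Q t s : D Q -> 0 <= t -> 0 <= s ->
  \sum_(P <- sel N Q t s) volr P <= Lambda * volr Q /\
  ((t = 0 -> F Q = 0) -> \sum_(P <- sel N Q t s) volr P <= Lambda *
    (F Q * volr Q / (K * t) +
     (s * volr Q + \sum_(P <- tree N Q) alpha P * volr P) / M)).
Proof.
have K0 : 0 < K := lt_le_trans ltr01 K1.
have L0 : 0 < Lambda := lt_trans ltr01 L1.
elim: N Q t s => [|N IH] Q t s DQ t0 s0; have v0 := volr_gt0 Q.
  rewrite !big_nil addr0; split=> [|_]; first by rewrite mulr_ge0// ltW.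
  by rewrite mulr_ge0 ?addr_ge0 ?divr_ge0 ?mulr_ge0 ?F0// ltW.
have G0 T : 0 <= \sum_(P <- tree N T) alpha P * volr P.
  by rewrite sumr_ge0// => P _; rewrite mulr_ge0// ltW// volr_gt0.
have GQ0 : 0 <= \sum_c \sum_(P <- tree N (child Q c)) alpha P * volr P.
  by rewrite sumr_ge0.
rewrite !sum_tree sum_sel; case: ifPn => [st|nst]; last first.
  split=> [|tF].
    rewrite -(sum_volr_child Q) mulr_sumr; apply: ler_sum => c _.
    by apply: (IH _ _ _ (dc c DQ) t0 _).1; rewrite addr_ge0.
  have -> : Lambda * (F Q * volr Q / (K * t) + (s * volr Q + (alpha Q * volr Q +
      \sum_c \sum_(P <- tree N (child Q c)) alpha P * volr P)) / M) =
    \sum_c Lambda * (F (child Q c) * volr (child Q c) / (K * t) +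
     ((s + alpha Q) * volr (child Q c) +
      \sum_(P <- tree N (child Q c)) alpha P * volr P) / M).
    rewrite -mulr_sumr big_split /= -!mulr_suml mF// big_split /= -mulr_sumr.
    by rewrite sum_volr_child addrA -mulrDl.
  apply: ler_sum => c _; apply: (IH _ _ _ (dc c DQ) t0 _).2.
    by rewrite addr_ge0.
  move=> /tF FQ0; have := mean_value_child c mF F0 DQ; rewrite FQ0 mulr0 => h.
  by apply/le_anti; rewrite h F0.
(* a stopping cube pays for the stopping cubes below it *)
have key : volr Q + \sum_c \sum_(P <- sel N (child Q c) (F Q) (alpha Q)) volr P
    <= Lambda * volr Q.
  have : \sum_c \sum_(P <- sel N (child Q c) (F Q) (alpha Q)) volr P <=
    \sum_c Lambda * (F (child Q c) * volr (child Q c) / (K * F Q) +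
     (alpha Q * volr (child Q c) +
      \sum_(P <- tree N (child Q c)) alpha P * volr P) / M).
    apply: ler_sum => c _; apply: (IH _ _ _ (dc c DQ) (F0 _) (alpha0 _)).2 => FQ0.
    have := mean_value_child c mF F0 DQ; rewrite FQ0 mulr0 => h.
    by apply/le_anti; rewrite h F0.
  rewrite -mulr_sumr big_split /= -!mulr_suml mF// big_split /= -mulr_sumr.
  rewrite sum_volr_child => h.
  have h1 : F Q * volr Q / (K * F Q) <= 1 / K * volr Q.
    have [->|Fn] := eqVneq (F Q) 0.
      by rewrite !mul0r mulr_ge0 ?divr_ge0// ltW.
    by rewrite le_eqVlt; apply/orP; left; apply/eqP; field; rewrite Fn gt_eqF.
  have h2 : (alpha Q * volr Q + \sum_c \sum_(P <- tree N (child Q c)) alpha P * volr P) / M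
      <= A / M * volr Q.
    rewrite mulrAC ler_pM2r ?invr_gt0//.
    by have := @alphaA N.+1 _ DQ; rewrite sum_tree.
  have h3 : Lambda * (1 / K * volr Q + A / M * volr Q) <= (Lambda - 1) * volr Q.
    by rewrite -mulrDl mulrA ler_pM2r// mulrC -ler_pdivlMr.
  have : Lambda * (F Q * volr Q / (K * F Q) + (alpha Q * volr Q +
    \sum_c \sum_(P <- tree N (child Q c)) alpha P * volr P) / M) <=
    Lambda * (1 / K * volr Q + A / M * volr Q).
    by rewrite ler_pM2l// lerD.
  lra.
split=> [//|tF]; apply: le_trans key _; rewrite ler_pM2l//.
have sv : 0 <= s * volr Q by rewrite mulr_ge0// ltW.
have av : 0 <= alpha Q * volr Q by rewrite mulr_ge0// ltW.
move: st => /orP[st|st].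
  have t1 : 0 < t.
    rewrite lt_neqAle t0 andbT eq_sym; apply/eqP => t00.
    by move: st; rewrite t00 mulr0 tF// ltxx.
  have : volr Q <= F Q * volr Q / (K * t).
    rewrite ler_pdivlMr; last by rewrite mulr_gt0.
    by rewrite mulrC ler_pM2r// ltW.
  move=> /le_trans; apply; rewrite lerDl divr_ge0 ?addr_ge0//; exact: ltW.
have : volr Q <= (s * volr Q + (alpha Q * volr Q +
    \sum_c \sum_(P <- tree N (child Q c)) alpha P * volr P)) / M.
  rewrite ler_pdivlMr// addrA -mulrDl mulrC.
  apply: le_trans (ler_wpM2r (ltW v0) (ltW st)) _.
  by rewrite lerDl.
by move=> /le_trans; apply; rewrite lerDr divr_ge0 ?mulr_ge0// ltW.
Qed.

(** For a cube [T] of the tree, the selected cubes inside [T] are those selected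
    from [T] in the state in which it is reached, and [sel_volume] does not
    depend on that state. *)
Lemma sel_carleson N Q t s T : D Q -> D T -> 0 <= t -> 0 <= s ->
  \sum_(P <- sel N Q t s | `[< cube_set P `<=` cube_set T >]) volr P <=
  Lambda * volr T.
Proof.
have L0 : 0 < Lambda := lt_trans ltr01 L1.
move=> + DT; elim: N Q t s => [|N IH] Q t s DQ t0 s0; have v0 := volr_gt0 T.
  by rewrite big_nil mulr_ge0// ltW.
have [QT|QT] := pselect (cube_set Q `<=` cube_set T).
  apply: le_trans (_ : \sum_(P <- sel N.+1 Q t s) volr P <= _).
    rewrite big_mkcond /=; apply: ler_sum => P _; case: ifP => // _.
    by rewrite ltW// volr_gt0.
  apply: le_trans (sel_volume _ DQ t0 s0).1 _.
  by rewrite ler_pM2l// volr_le// sub_level.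
have [TQ|TQ] := pselect (cube_set T `<=` cube_set Q); last first.
  rewrite big_seq_cond big1 ?mulr_ge0 1?ltW// => P /andP[PS /asboolP PT].
  have [DP _ PQ] := sel_grid DQ PS.
  have [pT pQ] := (PT _ (corner_in P), PQ _ (corner_in P)).
  have [h|h] := leP T.2 Q.2.
    by exfalso; apply/TQ/(grid_nested n_gt0 hD DT DQ h pT pQ).
  by exfalso; apply/QT/(grid_nested n_gt0 hD DQ DT (ltW h) pQ pT).
have lt : T.2 < Q.2.
  rewrite lt_neqAle (sub_level n_gt0 TQ) andbT; apply/eqP => e; apply: QT.
  by rewrite (grid_inj hD DT DQ e (corner_in T) (TQ _ (corner_in T))).
have Tc := grid_sub_child n_gt0 hD DT DQ lt (corner_in T) (TQ _ (corner_in T)).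
suff H t' s' : 0 <= t' -> 0 <= s' ->
    \sum_c \sum_(P <- sel N (child Q c) t' s' | `[< cube_set P `<=` cube_set T >])
      volr P <= Lambda * volr T.
  rewrite sum_sel; case: ifP => _; last by apply: H; rewrite ?addr_ge0.
  by case: asboolP => // _; rewrite add0r; apply: H.
move=> t'0 s'0; rewrite (bigD1 (octant Q T.1))//= [X in _ + X]big1 ?addr0.
  exact/IH/s'0/t'0/dc.
move=> c cT; rewrite big_seq_cond big1// => P /andP[PS /asboolP PT].
have [_ _ Pc] := sel_grid (dc c DQ) PS.
have /in_childP[_ h1] := Tc _ (PT _ (corner_in P)).
have /in_childP[_ h2] := Pc _ (corner_in P).
by rewrite -h2 h1 eqxx in cT.
Qed.

Lemma sum_indic_child Q x :
  \sum_c \1_(cube_set (child Q c)) x = \1_(cube_set Q) x :> R.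
Proof.
have [Qx|nQx] := pselect (cube_set Q x).
  rewrite (bigD1 (octant Q x))//= big1 ?addr0 => [|c cx].
    by rewrite !indicE !mem_set//; exact/in_childP.
  rewrite indicE memNset// => /in_childP[_ e].
  by rewrite e eqxx in cx.
rewrite big1 => [|c _]; rewrite indicE memNset//.
by move=> /in_childP[].
Qed.

(** Between two stopping cubes the averages of [f] are at most [K * t] and the
    values of [alpha] add up to at most [M]. The last term is the part of this
    budget that is still available in the state [(t, s)]. *)
Lemma sel_pointwise N Q t s x : D Q -> 0 <= t -> 0 <= s <= M ->
  \sum_(P <- tree N Q) alpha P * F P * \1_(cube_set P) x <=
  K * M * (\sum_(P <- sel N Q t s) F P * \1_(cube_set P) x) +
  K * t * (M - s) * \1_(cube_set Q) x.
Proof.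
have K0 : 0 <= K := le_trans ler01 K1.
have i0 P : 0 <= \1_(cube_set P) x :> R by rewrite indicE.
elim: N Q t s => [|N IH] Q t s DQ t0 /andP[s0 sM].

  by rewrite !big_nil mulr0 add0r !mulr_ge0// subr_ge0.
rewrite sum_tree sum_sel; have aM := le_trans (alpha_le DQ) AM.
have a0 := alpha0 Q.
have H t' s' : 0 <= t' -> 0 <= s' <= M ->
    \sum_c \sum_(P <- tree N (child Q c)) alpha P * F P * \1_(cube_set P) x <=
    K * M * (\sum_c \sum_(P <- sel N (child Q c) t' s') F P * \1_(cube_set P) x) +
    K * t' * (M - s') * \1_(cube_set Q) x.
  move=> t'0 s'0; rewrite -(sum_indic_child Q) !mulr_sumr -big_split /=.
  by apply: ler_sum => c _; apply: IH => //; exact: dc.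
case: ifPn => [st|]; last first.
  rewrite /stops negb_or -!leNgt => /andP[st1 st2].
  have h : alpha Q * F Q * \1_(cube_set Q) x <= alpha Q * (K * t) * \1_(cube_set Q) x.
    by rewrite ler_wpM2r// ler_wpM2l.
  have := H t (s + alpha Q) t0; rewrite addr_ge0// st2 => /(_ isT).
  have -> : K * t * (M - s) * \1_(cube_set Q) x =
    alpha Q * (K * t) * \1_(cube_set Q) x +
    K * t * (M - (s + alpha Q)) * \1_(cube_set Q) x by ring.
  lra.
have := H (F Q) (alpha Q) (F0 Q); rewrite a0 aM => /(_ isT) HH.
have h1 : 0 <= K * t * (M - s) * \1_(cube_set Q) x by rewrite !mulr_ge0// subr_ge0.
have h2 : alpha Q * F Q * \1_(cube_set Q) x <= K * alpha Q * (F Q * \1_(cube_set Q) x).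
  by rewrite -mulrA ler_wpM2r ?mulr_ge0// ler_peMl.
have e : K * F Q * (M - alpha Q) * \1_(cube_set Q) x =
  K * M * (F Q * \1_(cube_set Q) x) - K * alpha Q * (F Q * \1_(cube_set Q) x) by ring.
rewrite e in HH; rewrite mulrDr; lra.
Qed.

Lemma sum_disjoint_volr (s : seq (cube R n)) T k : uniq s ->
  (forall Q, Q \in s -> D Q /\ Q.2 = k) ->
  (forall Q, Q \in s -> cube_set Q `<=` cube_set T) ->
  \sum_(Q <- s) volr Q <= volr T.
Proof.
move=> us sk sT; rewrite -lee_fin -volrE -sumEFin.
under eq_bigr do rewrite -volrE.
rewrite fsbig_seq// /vol -measure_fin_bigcup//; last 2 first.
- move=> P Q /= /sk[DP Pk] /sk[DQ Qk] [x [Px Qx]].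
  by apply: (grid_inj hD DP DQ _ Px Qx); rewrite Pk.
- by move=> Q _; exact: measurable_cube.
apply: le_measure; rewrite ?inE; [|exact: measurable_cube|].
  by apply: fin_bigcup_measurable => // Q _; exact: measurable_cube.
by move=> x [Q /= /sT]; apply.
Qed.

(** A cube [T] is inside one root, or contains every root that it meets; in the
    latter case these roots are disjoint, and their volumes add up to at most
    that of [T]. *)
Lemma sel_top_carleson N (tops : seq (cube R n)) k T : uniq tops ->
  (forall Q, Q \in tops -> D Q /\ Q.2 = k) -> D T ->
  \sum_(Q <- tops) \sum_(P <- sel N Q 0 M | `[< cube_set P `<=` cube_set T >]) volr P
  <= Lambda * volr T.
Proof.
have L0 : 0 < Lambda := lt_trans ltr01 L1.
move=> ut tk DT.
have zero Q : Q \in tops -> ~ cube_set Q `<=` cube_set T ->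
    ~ cube_set T `<=` cube_set Q ->
    \sum_(P <- sel N Q 0 M | `[< cube_set P `<=` cube_set T >]) volr P = 0.
  move=> /tk[DQ _] QT TQ.
  rewrite big_seq_cond big1// => P /andP[PS /asboolP PT].
  have [DP _ PQ] := sel_grid DQ PS.
  have [pT pQ] := (PT _ (corner_in P), PQ _ (corner_in P)).
  have [h|h] := leP T.2 Q.2.
    by exfalso; apply/TQ/(grid_nested n_gt0 hD DT DQ h pT pQ).
  by exfalso; apply/QT/(grid_nested n_gt0 hD DQ DT (ltW h) pQ pT).
have [[Q [Qt TQ]]|noQ] := pselect (exists Q, Q \in tops /\ cube_set T `<=` cube_set Q).
  rewrite (bigD1_seq Q)//= [X in _ + X]big_seq_cond [X in _ + X]big1 ?addr0.
    by apply: sel_carleson => //; [exact: (tk Q Qt).1|exact: ltW].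
  move=> P /andP[Pt PQ].
  rewrite big_seq_cond big1// => P' /andP[P'S /asboolP P'T].
  have [DP Pk] := tk _ Pt; have [DQ Qk] := tk _ Qt.
  have [_ _ P'P] := sel_grid DP P'S.
  have := grid_inj hD DP DQ _ (P'P _ (corner_in P')) (TQ _ (P'T _ (corner_in P'))).
  by rewrite Pk Qk => /(_ erefl) e; rewrite e eqxx in PQ.
apply: le_trans (_ : \sum_(Q <- tops | `[< cube_set Q `<=` cube_set T >])
    Lambda * volr Q <= _).
  rewrite [leLHS]big_seq [leRHS]big_mkcond [leRHS]big_seq; apply: ler_sum => Q Qt.
  case: asboolP => QT; last by rewrite zero// => TQ; apply: noQ; exists Q.
  have [DQ _] := tk _ Qt.
  apply: le_trans (sel_volume N DQ (lexx 0) (ltW M0)).1.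
  rewrite big_mkcond /=; apply: ler_sum => P _; case: ifP => // _.
  by rewrite ltW// volr_gt0.
rewrite -mulr_sumr ler_pM2l// -big_filter; apply: (@sum_disjoint_volr _ _ k).
- exact: filter_uniq.
- by move=> Q; rewrite mem_filter => /andP[_ /tk].
- by move=> Q; rewrite mem_filter => /andP[/asboolP].
Qed.

(** A positive dyadic sum with Carleson coefficients is dominated by a sparse
    operator applied to the same function, whatever the Carleson constant
    [Lambda > 1] that is required. The finite family [s] is covered by finitely
    many trees with roots in one generation, and in each tree the stopping cubes
    are selected; starting with the budget [M] exhausted and [t = 0] makes every
    nonzero term select a cube at once. *)
Lemma sparse_domination (s : seq (cube R n)) : uniq s ->
  (forall Q, Q \in s -> D Q) ->
  exists S : seq (cube R n), [/\ uniq S, forall Q, Q \in S -> D Q,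
    forall T, D T -> \sum_(P <- S | `[< cube_set P `<=` cube_set T >]) volr P
      <= Lambda * volr T &
    forall x, \sum_(P <- s) alpha P * F P * \1_(cube_set P) x <=
      K * M * \sum_(P <- S) F P * \1_(cube_set P) x].
Proof.
move=> us sD.
have [k sk] : exists k : int, forall Q, Q \in s -> Q.2 <= k.
  elim: s {us sD} => [|Q s [k IH]]; first by exists 0.
  exists (Num.max k Q.2) => P; rewrite inE => /orP[/eqP ->|/IH h].
    by rewrite le_max lexx orbT.
  by rewrite le_max h.
have [N sN] : exists N : nat, forall Q, Q \in s -> k - Q.2 < N%:Z.
  elim: s {us sD sk} => [|Q s [N IH]]; first by exists 0%N.
  exists (N + `|k - Q.2|.+1)%N => P; rewrite inE => /orP[/eqP ->|/IH]; lia.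
have /choice[anc ancP] : forall Q, exists P, Q \in s ->
    [/\ D P, P.2 = k & cube_set Q `<=` cube_set P].
  move=> Q; case: (boolP (Q \in s)) => Qs; last by exists Q.
  by have [P ?] := grid_ancestor n_gt0 hD (sD _ Qs) (sk _ Qs); exists P.
pose tops := undup [seq anc Q | Q <- s].
have tk Q : Q \in tops -> D Q /\ Q.2 = k.
  by rewrite mem_undup => /mapP[P Ps ->]; have [] := ancP _ Ps.
exists (flatten [seq sel N Q 0 M | Q <- tops]); split.
- apply: uniq_flatten_disjoint; first exact: undup_uniq.
    by move=> Q /tk[DQ _]; exact: uniq_sel.
  move=> P Q T /tk[DP Pk] /tk[DQ Qk] /(sel_grid DP)[_ _ TP] /(sel_grid DQ)[_ _ TQ].
  apply: (grid_inj hD DP DQ _ (TP _ (corner_in T)) (TQ _ (corner_in T))).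
  by rewrite Pk.
- by move=> P /flattenP[_ /mapP[Q /tk[DQ _] ->] /(sel_grid DQ)[]].
- move=> T DT; rewrite big_flatten big_map.
  by apply: (@sel_top_carleson _ _ k) => //; exact: undup_uniq.
move=> x; apply: le_trans (_ : \sum_(Q <- tops) \sum_(P <- tree N Q)
    alpha P * F P * \1_(cube_set P) x <= _).
  have := ler_sum_subseq (F := fun P => alpha P * F P * \1_(cube_set P) x)
    (t := flatten [seq tree N Q | Q <- tops]) _ us; rewrite big_flatten big_map; apply.
    by move=> P; rewrite !mulr_ge0// indicE.
  move=> Q Qs; have [DP Pk QP] := ancP _ Qs; apply/flattenP.
  exists (tree N (anc Q)); first by apply: map_f; rewrite mem_undup map_f.
  by apply: mem_tree => //; [exact: sD|rewrite Pk sN].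
rewrite big_flatten big_map mulr_sumr big_seq [leRHS]big_seq.
apply: ler_sum => Q /tk[DQ _].
have := @sel_pointwise N Q 0 M x DQ (lexx 0) _; rewrite subrr mulr0 mul0r addr0.
by apply; rewrite lexx ltW.
Qed.

End sparse_domination.
End trees.

(** * Averages and dyadic BMO *)

Section averages.
Context (R : realType) (n : nat).
Local Notation mu := (leb R n).
Implicit Types (P Q : cube R n) (x : Rn R n) (c : {ffun 'I_n -> bool})
  (b f : Rn R n -> R).

Definition avgr b Q : R := (\int[mu]_(x in cube_set Q) b x) / volr Q.

Definition cube_integrable (D : set (cube R n)) b :=
  forall Q, D Q -> mu.-integrable (cube_set Q) (EFin \o b).

Lemma integrable_cst_cube Q (r : R) : mu.-integrable (cube_set Q) (EFin \o cst r).
Proof.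
apply/integrableP; split; first by apply/measurable_EFinP.
rewrite (_ : (fun x => _) = cst `|r|%:E)// integral_cst; last exact: measurable_cube.
by rewrite (_ : _ (cube_set Q) = (volr Q)%:E); [rewrite -EFinM ltry|exact: volrE].
Qed.

Lemma loc_integrable_cube D b : loc_integrable b -> cube_integrable D b.
Proof.
move=> [_ ib] Q _; have := ib (fun i => (tnth Q.1 i : R)) (fun i => (tnth Q.1 i : R) + side Q).
apply: integrableS; first by apply: measurable_box => i; exact: measurable_itv.
  exact: measurable_cube.
move=> x /in_cubeP H i /=; have [h1 h2] := H i.
by rewrite in_itv /= h1 ltW.
Qed.

Lemma avgr_vol b Q : avgr b Q * volr Q = \int[mu]_(x in cube_set Q) b x.
Proof. by rewrite /avgr divfK// gt_eqF// volr_gt0. Qed.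

Lemma avg_ge0 (g : Rn R n -> \bar R) Q : (forall x, (0 <= g x)%E) -> (0 <= avg g Q)%E.
Proof.
move=> g0; rewrite /avg volrE inver gt_eqF ?volr_gt0//; apply: mule_ge0.
  by apply: integral_ge0 => x _.
by rewrite lee_fin invr_ge0 ltW// volr_gt0.
Qed.

Lemma avgE b Q : mu.-integrable (cube_set Q) (EFin \o b) ->
  avg (EFin \o b) Q = (avgr b Q)%:E.
Proof.
move=> ib; rewrite /avg volrE inver gt_eqF ?volr_gt0// /avgr EFinM /Rintegral fineK//.
by apply: integrable_fin_num => //; exact: measurable_cube.
Qed.

Lemma avgr_cst (r : R) Q : avgr (cst r) Q = r.
Proof.
have v0 := volr_gt0 Q.
rewrite /avgr Rintegral_cst; last exact: measurable_cube.
by rewrite (_ : _ (cube_set Q) = (volr Q)%:E); [rewrite mulfK// gt_eqF|exact: volrE].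
Qed.

Lemma eq_avgr b f Q : (forall x, cube_set Q x -> b x = f x) -> avgr b Q = avgr f Q.
Proof. by move=> e; congr (_ / _); apply: eq_Rintegral => x /set_mem /e. Qed.

Lemma avgrB b f Q : mu.-integrable (cube_set Q) (EFin \o b) ->
  mu.-integrable (cube_set Q) (EFin \o f) ->
  avgr (fun x => b x - f x) Q = avgr b Q - avgr f Q.
Proof.
move=> ib jf; rewrite /avgr RintegralB ?mulrBl//; exact: measurable_cube.
Qed.

Lemma avgrD b f Q : mu.-integrable (cube_set Q) (EFin \o b) ->
  mu.-integrable (cube_set Q) (EFin \o f) ->
  avgr (fun x => b x + f x) Q = avgr b Q + avgr f Q.
Proof.
move=> ib jf; rewrite /avgr RintegralD ?mulrDl//; exact: measurable_cube.
Qed.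

Lemma avgr_ge0 b Q : (forall x, 0 <= b x) -> 0 <= avgr b Q.
Proof. by move=> b0; rewrite divr_ge0// ?Rintegral_ge0// ltW// volr_gt0. Qed.

Lemma le_avgr b f Q : mu.-integrable (cube_set Q) (EFin \o b) ->
  mu.-integrable (cube_set Q) (EFin \o f) ->
  (forall x, cube_set Q x -> b x <= f x) -> avgr b Q <= avgr f Q.
Proof.
move=> ib jf bf; rewrite ler_pM2r ?invr_gt0 ?volr_gt0//.
by apply: le_Rintegral => //; exact: measurable_cube.
Qed.

Lemma normr_avgr b Q : mu.-integrable (cube_set Q) (EFin \o b) ->
  `|avgr b Q| <= avgr (fun x => `|b x|) Q.
Proof.
move=> ib; rewrite normrM [`|_^-1|]ger0_norm; last by rewrite invr_ge0 ltW// volr_gt0.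
rewrite ler_pM2r ?invr_gt0 ?volr_gt0//.
by apply: le_normr_Rintegral => //; exact: measurable_cube.
Qed.

Lemma Rintegral_children Q b :
  measurable_fun (cube_set Q) b ->
  mu.-integrable (cube_set Q) (EFin \o b) ->
  \int[mu]_(x in cube_set Q) b x = \sum_c \int[mu]_(x in cube_set (child Q c)) b x.
Proof.
move=> mb ib; rewrite /Rintegral {1}cube_children integral_bigsetU_EFin.
- rewrite sum_fine// => c _; apply: integrable_fin_num; first exact: measurable_cube.
  by apply: integrableS ib; [exact: measurable_cube..|exact: child_sub].
- by move=> c; exact: measurable_cube.
- exact: index_enum_uniq.
- by move=> c d _ _; apply: trivIset_children.
- by rewrite -cube_children; apply/measurable_EFinP.
Qed.

Lemma mean_value_avgr D b : cube_integrable D b -> mean_value D (avgr b).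
Proof.
move=> ib Q DQ; rewrite avgr_vol (Rintegral_children _ (ib _ DQ)).
  by apply: eq_bigr => c _; rewrite avgr_vol.
by apply/measurable_EFinP; exact: (measurable_int mu (ib _ DQ)).
Qed.

Lemma cube_integrableB D b f : cube_integrable D b -> cube_integrable D f ->
  cube_integrable D (fun x => b x - f x).
Proof.
move=> ib jf Q DQ; have := integrableB (measurable_cube Q) (ib Q DQ) (jf Q DQ).
by apply: eq_integrable => //; exact: measurable_cube.
Qed.

Lemma cube_integrable_norm D b : cube_integrable D b ->
  cube_integrable D (fun x => `|b x|).
Proof. by move=> ib Q DQ; exact: integrable_norm (ib Q DQ). Qed.

Lemma cube_integrable_cst D (r : R) : cube_integrable D (cst r).
Proof. by move=> Q _; exact: integrable_cst_cube. Qed.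

Section bmo.
Variable D : set (cube R n).
Hypothesis n_gt0 : (0 < n)%N.
Hypothesis hD : dyadic_grid D.

Definition oscillation b Q0 Q := avgr (fun x => `|b x - avgr b Q0|) Q.

Lemma cube_integrable_osc b Q0 : cube_integrable D b ->
  cube_integrable D (fun x => `|b x - avgr b Q0|).
Proof.
move=> ib; apply: cube_integrable_norm; apply: cube_integrableB => //.
exact: cube_integrable_cst.
Qed.

Lemma bmo_normE b : cube_integrable D b ->
  bmo_norm D b = ereal_sup [set (oscillation b Q Q)%:E | Q in D].
Proof.
move=> ib; congr ereal_sup.
have E Q : D Q -> avg (fun x => `|(b x)%:E - avg (EFin \o b) Q|%E) Q =
    (oscillation b Q Q)%:E.
  move=> DQ; rewrite /oscillation -avgE ?(avgE (ib _ DQ))//.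
  exact: cube_integrable_osc.
by apply/seteqP; split => _ [Q DQ <-]; exists Q; rewrite ?E.
Qed.

Lemma oscillation_ge0 b Q0 Q : 0 <= oscillation b Q0 Q.
Proof. by apply: avgr_ge0 => x. Qed.

Lemma avgr_sub_le b Q0 Q : cube_integrable D b -> D Q ->
  `|avgr b Q - avgr b Q0| <= oscillation b Q0 Q.
Proof.
move=> ib DQ; rewrite -{1}[avgr b Q0](avgr_cst _ Q) -avgrB ?ib//.
  apply: normr_avgr; apply: cube_integrableB DQ => //; exact: cube_integrable_cst.
exact: integrable_cst_cube.
Qed.

Lemma bmo_norm_ge0 b : (exists Q, D Q) -> cube_integrable D b -> (0 <= bmo_norm D b)%E.
Proof.
move=> [Q DQ] ib; rewrite bmo_normE//; apply: ereal_sup_ge.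
by exists (oscillation b Q Q)%:E; [exists Q|rewrite lee_fin oscillation_ge0].
Qed.

Lemma oscillation_le b (B : R) Q : cube_integrable D b -> bmo_norm D b = B%:E -> D Q ->
  oscillation b Q Q <= B.
Proof.
move=> ib bB DQ; rewrite -lee_fin -bB bmo_normE//; apply: ereal_sup_ubound.
by exists Q.
Qed.

(** The oscillations over the cubes of the grid are averages of one function for
    each [Q0], as [variation_carleson] requires. *)
Lemma bmo_variation b (B : R) : loc_integrable b -> bmo_norm D b = B%:E -> 0 < B ->
  tree_carleson D (variation (avgr b)) (8 * 4 ^+ n * B ^+ 2).
Proof.
move=> /(@loc_integrable_cube D) ib bB B0.
apply: (variation_carleson n_gt0 hD (osc := oscillation b)) => //.
- exact: mean_value_avgr.
- by move=> Q0 DQ0; apply: mean_value_avgr; exact: cube_integrable_osc.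
- by move=> Q0 Q; exact: oscillation_ge0.
- by move=> Q0 Q DQ0 DQ; exact: avgr_sub_le.
- by move=> Q DQ; exact: oscillation_le bB DQ.
Qed.

(** Used to show that a norm is not 0. *)
Lemma avgr_child_bmo0 b : loc_integrable b -> bmo_norm D b = 0%E ->
  forall Q c, D Q -> avgr b (child Q c) = avgr b Q.
Proof.
move=> /(@loc_integrable_cube D) ib b0 Q c DQ.
apply/eqP; rewrite -subr_eq0 -normr_le0.
have DQc := grid_child n_gt0 hD c DQ.
apply: le_trans (avgr_sub_le Q ib DQc) _.
have mo := mean_value_avgr (cube_integrable_osc Q ib).
apply: le_trans (mean_value_child c mo _ DQ) _.
  by move=> P; exact: oscillation_ge0.
by rewrite pmulr_rle0 ?exprn_gt0//; apply: (oscillation_le ib b0 DQ).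
Qed.

End bmo.
End averages.

(** * Haar coefficients *)

Section haar.
Context (R : realType) (n : nat).
Local Notation mu := (leb R n).
Local Notation bits := {ffun 'I_n -> bool}.
Implicit Types (P Q : cube R n) (x : Rn R n) (c eps : bits) (b f : Rn R n -> R).

(** The sign of [haar Q eps] on the child [c] of [Q]. *)
Definition haar_sign eps c : R :=
  \prod_(i < n) (if eps i || c i then 1 else -1).

Lemma haar_sign_sqr eps c : haar_sign eps c ^+ 2 = 1.
Proof.
rewrite /haar_sign -prodrXl big1// => i _.
by case: ifP => _; rewrite ?sqrrN expr1n.
Qed.

Lemma haar_sign_norm eps c : `|haar_sign eps c| = 1.
Proof. by apply/eqP; rewrite -sqr_norm_eq1 haar_sign_sqr. Qed.

(** These signs are the characters of the group [(Z/2)^n]. *)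
Lemma sum_haar_sign2 eps eps' :
  \sum_c haar_sign eps c * haar_sign eps' c = (eps == eps')%:R * 2 ^+ n.
Proof.
transitivity (\sum_(c : bits) \prod_(i < n)
   ((if eps i || c i then 1 else -1) * (if eps' i || c i then 1 else -1) : R)).
  by apply: eq_bigr => c _; rewrite -big_split.
rewrite -(bigA_distr_bigA (fun i (d : bool) =>
  (if eps i || d then 1 else -1) * (if eps' i || d then 1 else -1) : R)).
have [->|neq] := eqVneq eps eps'.
  rewrite mul1r (eq_bigr (fun=> 2)) ?prodr_const ?card_ord// => i _.
  by rewrite big_bool /=; case: (eps' i) => /=; ring.
rewrite mul0r; have [i ei] : exists i, eps i != eps' i.
  apply/existsP; apply: contraNT neq => /existsPn H; apply/eqP/ffunP => i.
  by move: (H i); rewrite negbK => /eqP.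
rewrite (bigD1 i)//= big_bool /=; move: ei.
by case: (eps i); case: (eps' i) => //= _; rewrite -[RHS](mul0r 0); ring.
Qed.

Lemma haar_sign_true c : haar_sign [ffun=> true] c = 1.
Proof. by rewrite /haar_sign big1// => i _; rewrite ffunE. Qed.

Lemma sum_haar_sign eps : eps != [ffun=> true] -> \sum_c haar_sign eps c = 0.
Proof.
move=> /negbTE e; have := sum_haar_sign2 eps [ffun=> true].
by rewrite e mul0r; under eq_bigr do rewrite haar_sign_true mulr1.
Qed.

Definition haar_scale Q : R := (side Q `^ (- 2^-1)) ^+ n.

Lemma haar_scale_sqr Q : haar_scale Q ^+ 2 * volr Q = 1.
Proof.
rewrite /haar_scale /volr -exprM mulnC exprM -exprMn -powR_mulrn ?powR_ge0//.
rewrite -powRrM mulNr mulVf ?pnatr_eq0// powR_inv1 ?ltW ?side_gt0//.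
by rewrite mulVf ?expr1n// gt_eqF// side_gt0.
Qed.

Lemma half_indicators (u s t : R) : 0 < s -> (u <= t) && (t < u + s) = false ->
  ((u + s / 2 <= t) && (t < u + s))%:R - ((u <= t) && (t < u + s / 2))%:R = 0 :> R.
Proof.
move=> s0; case: (lerP u t) => [ut /= tu|tu _] /=.
  have us : u + s <= t by rewrite leNgt tu.
  rewrite tu andbF (_ : t < u + s / 2 = false) ?subrr//.
  by apply/negbTE; rewrite -leNgt; lra.
rewrite (_ : u + s / 2 <= t = false) ?subrr//.
by apply/negbTE; rewrite -ltNge; lra.
Qed.

Lemma haarE Q eps x :
  haar Q eps x = haar_scale Q * (\1_(cube_set Q) x * haar_sign eps (octant Q x)).
Proof.
rewrite /haar /haar1 big_split /= prodr_const card_ord -/(haar_scale Q).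
congr (_ * _); have s0 := side_gt0 Q.
have [Qx|nQx] := pselect (cube_set Q x).
  rewrite [\1_(cube_set Q) x]indicE mem_set// mul1r; apply: eq_bigr => i _.
  have /in_cubeP/(_ i)[h1 h2] := Qx; rewrite ffunE !indicE !mem_setE !in_itv /=.
  rewrite h1 h2 /=; case: (eps i) => //=; case: lerP => h3.
    by rewrite subr0.
  by rewrite sub0r.
rewrite indicE memNset// mul0r.
have [i ni] : exists i, ~ (tnth Q.1 i <= tnth x i :> R /\ tnth x i < tnth Q.1 i + side Q :> R).
  by apply/existsNP => H; apply/nQx/in_cubeP.
have ni' : (tnth Q.1 i <= tnth x i :> R) && (tnth x i < tnth Q.1 i + side Q :> R) = false.
  by apply/negbTE/negP => /andP.
rewrite (bigD1 i)//= !indicE !mem_setE !in_itv /= ni'.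
case: (eps i); first by rewrite mul0r.
by rewrite (half_indicators s0 ni') mul0r.
Qed.

Lemma octant_sum Q (G : bits -> R) x :
  \1_(cube_set Q) x * G (octant Q x) = \sum_c G c * \1_(cube_set (child Q c)) x.
Proof.
have [Qx|nQx] := pselect (cube_set Q x).
  rewrite (bigD1 (octant Q x))//= big1 ?addr0 => [|c cx].
    by rewrite !indicE !mem_set// ?mulr1 ?mul1r//; exact/in_childP.
  rewrite indicE memNset ?mulr0// => /in_childP[_ e].
  by rewrite e eqxx in cx.
rewrite big1 => [|c _]; rewrite indicE memNset ?mul0r ?mulr0//.
by move=> /in_childP[].
Qed.

Lemma measurable_octant Q (G : bits -> R) :
  measurable_fun setT (fun x => \1_(cube_set Q) x * G (octant Q x)).
Proof.
rewrite (_ : (fun x => _) =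
  (fun x => \sum_c G c * \1_(cube_set (child Q c)) x)); last first.
  by apply/funext => x; rewrite octant_sum.
apply: measurable_sum => c; apply: measurable_funM => //.
by apply: measurable_indic; exact: measurable_cube.
Qed.

Lemma measurable_haar Q eps : measurable_fun setT (haar Q eps).
Proof.
rewrite (_ : haar Q eps = fun x => haar_scale Q *
    (\1_(cube_set Q) x * haar_sign eps (octant Q x))); last first.
  by apply/funext => x; rewrite haarE.
by apply: measurable_funM => //; exact: (measurable_octant Q (haar_sign eps)).
Qed.

(** The Haar coefficient normalized so that the product of two of them is the
    coefficient of the operator: [(b, h_Q^eps) / |Q|^(1/2)]. *)
Definition haar_mean b Q eps : R :=
  (\sum_c haar_sign eps c * avgr b (child Q c)) / 2 ^+ n.

Lemma haar_coefE b Q eps : mu.-integrable (cube_set Q) (EFin \o b) ->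
  haar_coef b Q eps = (haar_scale Q * volr Q * haar_mean b Q eps)%:E.
Proof.
move=> ib; have ic c : mu.-integrable (cube_set (child Q c)) (EFin \o b).
  by apply: integrableS ib; [exact: measurable_cube..|exact: child_sub].
transitivity (\int[mu]_(x in cube_set Q) (b x * haar Q eps x)%:E)%E.
  rewrite [RHS]integral_mkcond; apply: eq_integral => x _.
  rewrite patchE; case: ifPn => // /negP xQ.
  by rewrite haarE indicE; case: (boolP (x \in _)) => // _; rewrite mul0r !mulr0.
rewrite {1}cube_children integral_bigsetU_EFin; last 4 first.
- by move=> c; exact: measurable_cube.
- exact: index_enum_uniq.
- by move=> c d _ _; apply: trivIset_children.
- rewrite -cube_children; apply/measurable_EFinP; apply: measurable_funM.
    by apply/measurable_EFinP; exact: (measurable_int mu ib).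
  by apply: measurable_funTS; exact: measurable_haar.
transitivity (\sum_c (haar_scale Q * haar_sign eps c *
   (avgr b (child Q c) * volr (child Q c)))%:E)%E.
  apply: eq_bigr => c _; rewrite avgr_vol EFinM /Rintegral fineK; last first.
    by apply: integrable_fin_num; [exact: measurable_cube|exact: ic].
  rewrite -integralZl//; last exact: measurable_cube.
  apply: eq_integral => x /set_mem /in_childP[Qx <-].
  by rewrite haarE indicE mem_set// mul1r -EFinM mulrC.
rewrite sumEFin; congr EFin; rewrite /haar_mean mulr_suml mulr_sumr.
by apply: eq_bigr => c _; rewrite volr_child; ring.
Qed.

(** As the signs have mean zero, the mean of [b] may be subtracted, and the
    difference of the two sides is the variance of
    [haar_sign eps c * (avgr b (child Q c) - avgr b Q)] over the children. *)
Lemma haar_mean_sqr b Q eps : eps != [ffun=> true] ->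
  haar_mean b Q eps ^+ 2 <= variation (avgr b) Q.
Proof.
move=> e1; set X := haar_mean b Q eps.
pose d c := avgr b (child Q c) - avgr b Q.
have n0 : (2 : R) ^+ n != 0 by rewrite expf_neq0.
have XE : \sum_c haar_sign eps c * d c = X * 2 ^+ n.
  rewrite /X /haar_mean divfK// /d; under eq_bigr do rewrite mulrBr.
  by rewrite sumrB -mulr_suml sum_haar_sign// mul0r subr0.
rewrite -subr_ge0.
suff -> : variation (avgr b) Q - X ^+ 2 =
    \sum_c (haar_sign eps c * d c - X) ^+ 2 / 2 ^+ n.
  by apply: sumr_ge0 => c _; rewrite divr_ge0 ?sqr_ge0 ?exprn_ge0.
transitivity (\sum_c (d c ^+ 2 / 2 ^+ n +
   (- (2 * X / 2 ^+ n) * (haar_sign eps c * d c) + X ^+ 2 / 2 ^+ n))).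
  rewrite big_split /= big_split /= -mulr_sumr XE sum_bits_cst.
  by rewrite /variation; field.
apply: eq_bigr => c _; have s2 := haar_sign_sqr eps c.
rewrite [(haar_sign eps c * d c - X) ^+ 2]sqrrB [(haar_sign eps c * d c) ^+ 2]exprMn s2.
by field.
Qed.

(** The positive numbers [u] and [v] are for the two BMO norms, by which the
    variations are normalized before the inequality [2 x y <= x^2 + y^2]. *)
Lemma sum_haar_mean_le a b Q (u v : R) : 0 < u -> 0 < v ->
  \sum_(eps : bits | eps != [ffun=> true]) `|haar_mean a Q eps * haar_mean b Q eps|
  <= 2 ^+ n / 2 * (variation (avgr a) Q / u ^+ 2 + variation (avgr b) Q / v ^+ 2) * (u * v).
Proof.
move=> u0 v0.
set W := (variation (avgr a) Q / u ^+ 2 + variation (avgr b) Q / v ^+ 2).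
have V0 (g : cube R n -> R) : 0 <= variation g Q.
  by apply: sumr_ge0 => c _; rewrite divr_ge0 ?sqr_ge0 ?exprn_ge0.
have W0 : 0 <= W by rewrite addr_ge0// divr_ge0 ?V0 ?sqr_ge0.
apply: le_trans (_ : \sum_(eps : bits) W / 2 * (u * v) <= _); last first.
  rewrite sum_bits_cst.
  by rewrite le_eqVlt; apply/orP; left; apply/eqP; ring.
rewrite big_mkcond; apply: ler_sum => eps _; case: ifPn => [e1|_]; last first.
  by rewrite !mulr_ge0// ltW.
set s := haar_mean a Q eps; set t := haar_mean b Q eps.
have hs : (s / u) ^+ 2 <= variation (avgr a) Q / u ^+ 2.
  by rewrite exprMn exprVn ler_pM2r ?haar_mean_sqr// invr_gt0 exprn_gt0.
have ht : (t / v) ^+ 2 <= variation (avgr b) Q / v ^+ 2.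
  by rewrite exprMn exprVn ler_pM2r ?haar_mean_sqr// invr_gt0 exprn_gt0.
have -> : `|s * t| = `|(s / u) * (t / v)| * (u * v).
  rewrite -[in RHS](gtr0_norm (mulr_gt0 u0 v0)) -normrM; congr `|_|.
  by field; rewrite !gt_eqF.
rewrite ler_pM2r ?mulr_gt0// ler_norml.
have h1 := sqr_ge0 (s / u + t / v); have h2 := sqr_ge0 (s / u - t / v).
move: h1 h2; rewrite sqrrD sqrrB; rewrite /W.
by move=> h1 h2; apply/andP; split; lra.
Qed.

Lemma paraproduct_term a b Q eps (f : \bar R) x :
  mu.-integrable (cube_set Q) (EFin \o a) -> mu.-integrable (cube_set Q) (EFin \o b) ->
  (haar_coef a Q eps * haar_coef b Q eps * f * ((\1_(cube_set Q) x)%:E / vol Q) =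
   (haar_mean a Q eps * haar_mean b Q eps)%:E * (f * (\1_(cube_set Q) x)%:E))%E.
Proof.
move=> ia ib; rewrite !haar_coefE// volrE inver gt_eqF ?volr_gt0//.
rewrite -EFinM [((\1_(cube_set Q) x)%:E * _)%E]muleC muleACA -EFinM.
congr (_%:E * _)%E.
transitivity (haar_mean a Q eps * haar_mean b Q eps * (haar_scale Q ^+ 2 * volr Q)).
  by field; rewrite gt_eqF// volr_gt0.
by rewrite haar_scale_sqr mulr1.
Qed.

End haar.

(** * Countable sums and norms *)

Section sums.
Local Open Scope ereal_scope.
Context (R : realType) (T : choiceType).
Implicit Types (s : seq T) (u : T -> \bar R) (S : set T).

Lemma esum_seq s u : uniq s -> (forall i, 0 <= u i) ->
  \esum_(i in [set` s]) u i = \sum_(i <- s) u i.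
Proof. by move=> us u0; rewrite esum_fset// -fsbig_seq. Qed.

Lemma sum_over_ge0 S u : (forall i, 0 <= u i) -> sum_over S u = \esum_(i in S) u i.
Proof.
move=> u0; rewrite /sum_over [X in _ - X]esum1 ?sube0; last first.
  by move=> i _; rewrite funenegE; apply/max_idPr; rewrite oppe_le0.
by apply: eq_esum => i _; rewrite funeposE; apply/max_idPl.
Qed.

Lemma abse_sum_over S u : `|sum_over S u| <= \esum_(i in S) `|u i|.
Proof.
rewrite /sum_over; apply: le_trans (lee_abs_sub _ _) _.
rewrite !gee0_abs ?esum_ge0// -esumD//.
by apply: le_esum => i _; rewrite -[X in _ <= X]/((abse \o u) i) fune_abse.
Qed.

(** A sum over a countable set is the limit of the sums over an increasing
    sequence of finite subsets, the same for all families of terms. *)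
Lemma countable_exhaustion S : countable S ->
  exists s_ : nat -> seq T, [/\ forall N, uniq (s_ N),
    forall N i, i \in s_ N -> S i,
    forall u N M, (forall i, 0 <= u i) -> (N <= M)%N ->
      \sum_(i <- s_ N) u i <= \sum_(i <- s_ M) u i &
    forall u, (forall i, 0 <= u i) ->
      \esum_(i in S) u i = ereal_sup (range (fun N => \sum_(i <- s_ N) u i))].
Proof.
move=> /countable_injP[f finj].
have /choice[h hP] : forall k : nat, exists h : seq T,
    [/\ uniq h, forall i, i \in h -> S i /\ f i = k & forall i, S i -> f i = k -> i \in h].
  move=> k; have [[i [Si fi]]|no] := pselect (exists i, S i /\ f i = k).
    exists [:: i]; split=> //; first by move=> j; rewrite inE => /eqP ->.
    by move=> j Sj fj; rewrite inE; apply/eqP/finj; rewrite ?inE// fj fi.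
  by exists [::]; split=> // i Si fi; exfalso; apply: no; exists i.
pose s_ N := flatten [seq h k | k <- iota 0 N].
have us N : uniq (s_ N).
  apply: uniq_flatten_disjoint; first exact: iota_uniq.
    by move=> k _; have [] := hP k.
  move=> j k i _ _ ij ik; have [_ /(_ _ ij)[_ <-] _] := hP j.
  by have [_ /(_ _ ik)[_ <-] _] := hP k.
have sS N i : i \in s_ N -> S i.
  by move=> /flattenP[_ /mapP[k _ ->]]; have [_ + _] := hP k => /[apply] -[].
exists s_; split=> //.
- move=> u N M u0 NM; rewrite /s_ -(subnKC NM) iotaD map_cat flatten_cat big_cat /=.
  by rewrite leeDl// sume_ge0.
- move=> u u0; apply/eqP; rewrite eq_le; apply/andP; split; last first.
    apply: ge_ereal_sup => _ [N _ <-]; rewrite -esum_seq//.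
    apply: ge_ereal_sup => _ [A [finA As] <-]; apply: ereal_sup_ubound.
    by exists A => //; split=> // i /As /= /sS.
  apply: ge_ereal_sup => _ [A [finA AS] <-].
  have [N AN] : exists N, A `<=` [set` s_ N].
    have [N fN] : exists N, forall i, A i -> (f i < N)%N.
      have /finite_seqP[t tE] := finA; exists (\max_(i <- t) f i).+1 => i.
      rewrite tE ltnS /= => it; rewrite (big_rem i)//=; exact: leq_maxl.
    exists N => i Ai; apply/flattenP; exists (h (f i)); last first.
      by have [_ _] := hP (f i); apply=> //; exact: AS.
    by apply/mapP; exists (f i) => //; rewrite mem_iota add0n fN.
  apply: le_trans (_ : \sum_(i <- s_ N) u i <= _); last first.
    by apply: ereal_sup_ubound; exists N.
  by rewrite -esum_seq//; apply: ereal_sup_ubound; exists A.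
Qed.

End sums.

Section lnorm.
Local Open Scope ereal_scope.
Context d (T : measurableType d) (R : realType).
Variables (nu : {measure set T -> \bar R}) (p : R).
Hypothesis p0 : (0 < p)%R.

(** The integral of a nonnegative function is a supremum over the simple
    functions below it, and these remain below any larger function. *)
Lemma le_ge0_integral (f g : T -> \bar R) : (forall x, 0 <= f x) ->
  (forall x, f x <= g x) -> \int[nu]_x f x <= \int[nu]_x g x.
Proof.
move=> f0 fg; rewrite !ge0_integralTE//; last by move=> x; exact: le_trans (fg x).
apply: ge_ereal_sup => _ [h /= hf <-]; apply: ereal_sup_ubound.
by exists h => //= x; exact: le_trans (fg x).
Qed.

Lemma le_poweR (x y : \bar R) (r : R) : (0 <= r)%R -> 0 <= x -> x <= y ->
  x `^ r <= y `^ r.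
Proof.
by move=> r0 x0 xy; apply: gt0_ler_poweR => //; rewrite in_itv /= ?leey ?andbT//;
  exact: le_trans xy.
Qed.

Lemma le_Lnorm (f g : T -> \bar R) : (forall x, `|f x| <= `|g x|) ->
  'N[nu]_p%:E[f] <= 'N[nu]_p%:E[g].
Proof.
move=> fg; rewrite unlock; apply: le_poweR.
- by rewrite invr_ge0 ltW.
- by apply: integral_ge0 => x _; exact: poweR_ge0.
- apply: le_ge0_integral => x; first exact: poweR_ge0.
  by apply: le_poweR => //; exact: ltW.
Qed.

Lemma LnormZl (k : R) (g : T -> \bar R) : (0 <= k)%R -> measurable_fun setT g ->
  'N[nu]_p%:E[(fun x => k%:E * g x)] = k%:E * 'N[nu]_p%:E[g].
Proof.
move=> k0 mg; rewrite unlock /=.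
transitivity ((\int[nu]_x ((k `^ p)%:E * `|g x| `^ p)) `^ p^-1).
  congr (_ `^ _); apply: eq_integral => x _.
  by rewrite abseM poweRM// gee0_abs// poweR_EFin.
rewrite ge0_integralZl//; last 3 first.
- apply: (measurableT_comp (measurable_poweR _)); exact: measurableT_comp.
- by move=> x _; exact: poweR_ge0.
- by rewrite lee_fin powR_ge0.
rewrite poweRM ?lee_fin ?powR_ge0//; last first.
  by apply: integral_ge0 => x _; exact: poweR_ge0.
by rewrite poweR_EFin -powRrM mulfV ?gt_eqF// powRr1.
Qed.

(** Monotone convergence, the power being moved inside the supremum by
    monotonicity alone. *)
Lemma Lnorm_sup (g_ : nat -> T -> \bar R) (B : \bar R) :
  (forall N, measurable_fun setT (g_ N)) -> (forall N x, 0 <= g_ N x) ->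
  (forall N M x, (N <= M)%N -> g_ N x <= g_ M x) ->
  (forall N, 'N[nu]_p%:E[g_ N] <= B) ->
  'N[nu]_p%:E[(fun x => ereal_sup (range (g_ ^~ x)))] <= B.
Proof.
move=> mg g0 gN gB.
have B0 : 0 <= B := le_trans (Lnorm_ge0 _ _ _) (gB 0%N).
have nd x : {homo (fun N => g_ N x `^ p) : n m / (n <= m)%N >-> n <= m}.
  by move=> N M NM; apply: le_poweR => //; [exact: ltW|exact: gN].
have s0 x : 0 <= ereal_sup (range (g_ ^~ x)).
  by apply: le_trans (g0 0%N x) _; apply: ereal_sup_ubound; exists 0%N.
have supE x : limn (fun N => g_ N x `^ p) = ereal_sup (range (fun N => g_ N x `^ p)).
  by apply/cvg_lim => //; exact: ereal_nondecreasing_cvgn.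
have key : \int[nu]_x (`|ereal_sup (range (g_ ^~ x))| `^ p) <= B `^ p.
  apply: le_trans (_ : \int[nu]_x limn (fun N => g_ N x `^ p) <= _).
    apply: le_ge0_integral => x; first exact: poweR_ge0.
    rewrite gee0_abs// supE.
    set L := ereal_sup (range (fun N => g_ N x `^ p)).
    have L0 : 0 <= L.
      by apply: le_trans (poweR_ge0 (g_ 0%N x) p) _; apply: ereal_sup_ubound; exists 0%N.
    have -> : L = (L `^ p^-1) `^ p by rewrite -poweRrM mulVf ?gt_eqF// poweRe1.
    apply: le_poweR => //; first exact: ltW.
    apply: ge_ereal_sup => _ [N _ <-].
    rewrite -[leLHS]poweRe1// -(@mulfV _ p) ?gt_eqF// poweRrM.
    apply: le_poweR; [by rewrite invr_ge0 ltW|exact: poweR_ge0|].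
    by apply: ereal_sup_ubound; exists N.
  rewrite (monotone_convergence nu measurableT (g' := fun N x => g_ N x `^ p)).
  - apply: lime_le.
      apply: ereal_nondecreasing_is_cvgn => N M NM.
      by apply: le_ge0_integral => x; [exact: poweR_ge0|exact: nd].
    apply: nearW => N; rewrite (_ : \int[nu]_x _ = 'N[nu]_p%:E[g_ N] `^ p).
      by apply: le_poweR; [exact: ltW|exact: Lnorm_ge0|exact: gB].
    rewrite poweR_Lnorm ?gt_eqF//; apply: eq_integral => x _.
    by rewrite gee0_abs.
  - by move=> N; exact: (measurableT_comp (measurable_poweR _)).
  - by move=> N x _; exact: poweR_ge0.
  - by move=> x _; exact: nd.
rewrite unlock; apply: le_trans (_ : (B `^ p) `^ p^-1 <= _); last first.
  by rewrite -poweRrM mulfV ?gt_eqF// poweRe1.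
apply: le_poweR => //; first by rewrite invr_ge0 ltW.
by apply: integral_ge0 => x _; exact: poweR_ge0.
Qed.

End lnorm.

Section cubes_lnorm.
Local Open Scope ereal_scope.
Context (R : realType) (n : nat).
Implicit Types (P Q : cube R n) (x : Rn R n).

(** Cubes of the same level are disjoint, so a cube is determined by its level
    and a point of rational coordinates in it. *)
Lemma countable_grid (D : set (cube R n)) : dyadic_grid D -> countable D.
Proof.
move=> hD.
have /choice[r rP] : forall Q : cube R n, exists r : {ffun 'I_n -> rat},
    cube_set Q [tuple (ratr (r i) : R) | i < n].
  move=> Q; have /choice[r rP] : forall i : 'I_n, exists r : rat,
      ratr r \in `](tnth Q.1 i : R), ((tnth Q.1 i : R) + side Q)%R[.
    by move=> i; apply: rat_in_itvoo; rewrite ltrDl side_gt0.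
  exists [ffun i => r i]; apply/in_cubeP => i; rewrite tnth_mktuple ffunE.
  by have := rP i; rewrite in_itv /= => /andP[/ltW ? ?].
apply/countable_injP; exists (fun Q => pickle (r Q, Q.2)) => P Q /set_mem DP /set_mem DQ.
move=> /(pcan_inj pickleK)[rPQ PQ].
by apply: (grid_inj hD DP DQ PQ (rP P)); rewrite rPQ.
Qed.

Lemma measurable_seq_sum (s : seq (cube R n)) (u : cube R n -> \bar R) :
  measurable_fun setT (fun x => \sum_(Q <- s) u Q * (\1_(cube_set Q) x)%:E).
Proof.
apply: emeasurable_sum => Q; apply: emeasurable_funM => //.
apply/measurable_EFinP; apply: measurable_indic; exact: measurable_cube.
Qed.

(** It is by this lemma that both inequalities of the theorem are reduced to
    finite families of cubes. *)
Lemma Lnorm_esum (nu : {measure set Rn R n -> \bar R}) (p : R) (S : set (cube R n))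
    (u : cube R n -> \bar R) (B : \bar R) :
  (0 < p)%R -> countable S -> (forall Q, 0 <= u Q) ->
  (forall s : seq (cube R n), uniq s -> (forall Q, Q \in s -> S Q) ->
    'N[nu]_p%:E[(fun x => \sum_(Q <- s) u Q * (\1_(cube_set Q) x)%:E)] <= B) ->
  'N[nu]_p%:E[(fun x => \esum_(Q in S) (u Q * (\1_(cube_set Q) x)%:E))] <= B.
Proof.
move=> p0 /(@countable_exhaustion R _ _)[s_ [us sS smon sE]] u0 H.
have u10 x Q : 0 <= u Q * (\1_(cube_set Q) x)%:E.
  by rewrite mule_ge0// lee_fin indicE.
under [X in 'N[_]_ _[X]]funext do rewrite sE//.
apply: (Lnorm_sup p0) => [N|N x|N M x NM|N].
- exact: measurable_seq_sum.
- exact: sume_ge0.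
- exact: smon.
- by apply: H => // Q; exact: sS.
Qed.

End cubes_lnorm.

(** * Sums of Haar functions over a Carleson family *)

Section test_function.
Context (R : realType) (n : nat).
Local Notation mu := (leb R n).
Local Notation bits := {ffun 'I_n -> bool}.
Local Notation sgn0 := (haar_sign R [ffun=> false]) (only parsing).
Implicit Types (P Q T : cube R n) (x : Rn R n) (c eps : bits) (s : seq (cube R n)).

(** The Haar function [h_T^0] times [|T|^(1/2)]. *)
Definition haar0 T x : R :=
  \1_(cube_set T) x * sgn0 (octant T x).

Definition haar0_sum s x : R := \sum_(T <- s) haar0 T x.

Lemma haar0_norm T x : `|haar0 T x| = \1_(cube_set T) x.
Proof. by rewrite /haar0 normrM haar_sign_norm mulr1 ger0_norm// indicE. Qed.

Lemma haar0_out T x : ~ cube_set T x -> haar0 T x = 0.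
Proof. by move=> Tx; rewrite /haar0 indicE memNset// mul0r. Qed.

Lemma haar0_child T c x : cube_set (child T c) x ->
  haar0 T x = sgn0 c.
Proof. by move=> /in_childP[Tx <-]; rewrite /haar0 indicE mem_set// mul1r. Qed.

Lemma measurable_haar0 T : measurable_fun setT (haar0 T).
Proof. exact: measurable_octant. Qed.

Lemma integrable_indic_cube T : mu.-integrable setT (EFin \o \1_(cube_set T)).
Proof.
have mT := measurable_cube T.
apply/integrableP; split; first by apply/measurable_EFinP; exact: measurable_indic.
under eq_integral do rewrite /= ger0_norm ?indicE ?ler0n// -indicE.
rewrite integral_indic// setIT (_ : _ (cube_set T) = (volr T)%:E) ?ltry//.
exact: volrE.
Qed.

Lemma integrable_haar0 T : mu.-integrable setT (EFin \o haar0 T).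
Proof.
apply: (le_integrable _ _ _ (integrable_indic_cube T)) => //.
  by apply/measurable_EFinP; exact: measurable_haar0.
move=> x _ /=; rewrite haar0_norm ger0_norm// indicE ler0n.
Qed.

Lemma integrable_sum_real (I : Type) (s : seq I) (p : pred I) (h : I -> Rn R n -> R)
    (A : set (Rn R n)) : measurable A ->
  (forall i, p i -> mu.-integrable A (EFin \o h i)) ->
  mu.-integrable A (EFin \o (fun x => \sum_(i <- s | p i) h i x)).
Proof.
move=> mA ih; have := integrable_sum mA s ih.
by apply: eq_integrable => // x _ /=; rewrite sumEFin.
Qed.

Lemma avgr_sum (I : Type) (s : seq I) (p : pred I) (h : I -> Rn R n -> R) Q :
  (forall i, p i -> mu.-integrable (cube_set Q) (EFin \o h i)) ->
  avgr (fun x => \sum_(i <- s | p i) h i x) Q = \sum_(i <- s | p i) avgr (h i) Q.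
Proof.
move=> ih; elim: s => [|i s IH].
  rewrite big_nil (eq_avgr (f := cst 0)) ?avgr_cst// => x _.
  by rewrite big_nil.
rewrite big_cons; case: ifPn => pi; last first.
  by rewrite -IH; apply: eq_avgr => x _; rewrite big_cons (negbTE pi).
rewrite -IH -avgrD ?ih//.
  by apply: eq_avgr => x _; rewrite big_cons pi.
by apply: integrable_sum_real => //; exact: measurable_cube.
Qed.

Lemma integrable_haar0_cube T Q : mu.-integrable (cube_set Q) (EFin \o haar0 T).
Proof.
by apply: integrableS (integrable_haar0 T) => //; exact: measurable_cube.
Qed.

Lemma haar0_sum_loc_integrable s : loc_integrable (haar0_sum s).
Proof.
split; first by apply: measurable_sum => T; exact: measurable_haar0.
move=> u v.
have mB : measurable (box (fun i => `[u i, v i]%classic)).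
  by apply: measurable_box => i; exact: measurable_itv.
apply: integrable_sum_real => // T _.
by apply: integrableS (integrable_haar0 T).
Qed.

Lemma avgr_haar0_sum s Q : avgr (haar0_sum s) Q = \sum_(T <- s) avgr (haar0 T) Q.
Proof. by apply: avgr_sum => T _; exact: integrable_haar0_cube. Qed.

Lemma avgr_indic T Q : cube_set T `<=` cube_set Q ->
  avgr \1_(cube_set T) Q = volr T / volr Q.
Proof.
move=> TQ; rewrite /avgr /Rintegral integral_indic; [|exact: measurable_cube..].
by rewrite setIidl// (_ : _ (cube_set T) = (volr T)%:E)//; exact: volrE.
Qed.

Section grid.
Variables (D : set (cube R n)).
Hypothesis n_gt0 : (0 < n)%N.
Hypothesis hD : dyadic_grid D.

Lemma bits_neq : [ffun=> false] != [ffun=> true] :> bits.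
Proof.
by apply/eqP => /ffunP /(_ (Ordinal n_gt0)); rewrite !ffunE.
Qed.

(** Either [P] is disjoint from [T] or it is inside one child of [T]. *)
Lemma haar0_cst T P : D T -> D P -> ~ cube_set T `<=` cube_set P ->
  exists k, forall x, cube_set P x -> haar0 T x = k.
Proof.
move=> DT DP TP.
have [[x [Tx Px]]|dis] := pselect (exists x, cube_set T x /\ cube_set P x); last first.
  by exists 0 => x Px; apply: haar0_out => Tx; apply: dis; exists x.
have lt : P.2 < T.2.
  by rewrite ltNge; apply/negP => le; apply: TP; exact: (grid_nested n_gt0 hD DT DP le Tx Px).
exists (sgn0 (octant T x)) => y Py.
by apply: haar0_child; apply: (grid_sub_child n_gt0 hD DP DT lt Px Tx).
Qed.

Lemma avgr_haar0_sub T Q : cube_set T `<=` cube_set Q -> avgr (haar0 T) Q = 0.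
Proof.
move=> TQ.
suff E : \int[mu]_(x in cube_set Q) haar0 T x = 0 by rewrite /avgr E mul0r.
transitivity (\int[mu]_(x in cube_set T) haar0 T x).
  rewrite [LHS]Rintegral_mkcond [RHS]Rintegral_mkcond; apply: eq_Rintegral => x _.
  rewrite !patchE; case: (boolP (x \in cube_set T)) => xT.
    by rewrite mem_set//; apply: TQ; exact: set_mem.
  by case: ifP => // _; apply: haar0_out => /mem_set; rewrite (negbTE xT).
rewrite Rintegral_children; last 2 first.
- by apply: measurable_funTS; exact: measurable_haar0.
- exact: integrable_haar0_cube.
rewrite (eq_bigr (fun c => sgn0 c * (volr T / 2 ^+ n))).
  by rewrite -mulr_suml sum_haar_sign ?mul0r// bits_neq.
move=> c _; rewrite -(volr_child T c) -avgr_vol; congr (_ * _).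
by rewrite (eq_avgr (f := cst (sgn0 c))) ?avgr_cst// => x /haar0_child.
Qed.

(** Orthogonality of the Haar functions of distinct cubes, in the form that the
    averages of [haar0 T] do not distinguish the children of another cube [Q]. *)
Lemma avgr_haar0_child T Q c : D T -> D Q ->
  avgr (haar0 T) (child Q c) =
  if T == Q then sgn0 c else avgr (haar0 T) Q.
Proof.
move=> DT DQ; case: eqP => [->|TQ].
  by rewrite (eq_avgr (f := cst (sgn0 c))) ?avgr_cst// => x /haar0_child.
have [sTQ|nTQ] := pselect (cube_set T `<=` cube_set Q); last first.
  have [k kE] := haar0_cst DT DQ nTQ.
  rewrite !(eq_avgr (b := haar0 T) (f := cst k)) ?avgr_cst// => x /child_sub; exact: kE.
rewrite (avgr_haar0_sub sTQ).
have Tx := corner_in T; have Qx := sTQ _ Tx.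
have lt : T.2 < Q.2.
  rewrite lt_neqAle (sub_level n_gt0 sTQ) andbT; apply/eqP => e.
  by apply: TQ; exact: (grid_inj hD DT DQ e Tx Qx).
have Tc := grid_sub_child n_gt0 hD DT DQ lt Tx Qx.
have [<-|cT] := eqVneq (octant Q T.1) c; first exact: avgr_haar0_sub.
rewrite (eq_avgr (f := cst 0)) ?avgr_cst// => x /in_childP[_ cx]; apply: haar0_out.
by move=> /Tc /in_childP[_ h]; rewrite -h cx eqxx in cT.
Qed.

Lemma haar_mean_haar0_sum s Q eps : uniq s -> (forall T, T \in s -> D T) -> D Q ->
  eps != [ffun=> true] ->
  haar_mean (haar0_sum s) Q eps = ((Q \in s) && (eps == [ffun=> false]))%:R.
Proof.
move=> us sD DQ e1.
have H c : avgr (haar0_sum s) (child Q c) = avgr (haar0_sum s) Q +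
    (Q \in s)%:R * sgn0 c.
  rewrite !avgr_haar0_sum; case: (boolP (Q \in s)) => Qs; last first.
    rewrite mul0r addr0 big_seq [RHS]big_seq; apply: eq_bigr => T Ts.
    have TQ : T != Q by apply: contraNneq Qs => <-.
    by rewrite (avgr_haar0_child c (sD _ Ts) DQ) (negbTE TQ).
  rewrite !(bigD1_seq Q Qs us)/= avgr_haar0_child// eqxx (avgr_haar0_sub (@subset_refl _ _)).
  rewrite add0r mul1r addrC; congr (_ + _).
  rewrite big_seq_cond [RHS]big_seq_cond; apply: eq_bigr => T /andP[Ts TQ].
  by rewrite (avgr_haar0_child c (sD _ Ts) DQ) (negbTE TQ).
move: (avgr (haar0_sum s) Q) H => m H.
rewrite /haar_mean; under eq_bigr do rewrite H mulrDr mulrCA.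
rewrite big_split /=. rewrite  -mulr_suml sum_haar_sign// mul0r add0r -mulr_sumr sum_haar_sign2.
by rewrite mulrA mulfK ?expf_neq0// -natrM mulnb.
Qed.

(** The terms with [T] not inside [Q] are constant on [Q] and those inside have
    mean zero, so the oscillation over [Q] is that of the latter, at most the
    average of the sum of the indicators. *)
Lemma haar0_sum_bmo s (Lambda : R) : uniq s -> (forall T, T \in s -> D T) ->
  (forall T, D T -> \sum_(P <- s | `[< cube_set P `<=` cube_set T >]) volr P
    <= Lambda * volr T) ->
  (bmo_norm D (haar0_sum s) <= Lambda%:E)%E.
Proof.
move=> us sD sC; have iD := @loc_integrable_cube _ _ D _ (haar0_sum_loc_integrable s).
rewrite bmo_normE//; apply: ge_ereal_sup => _ [Q DQ <-]; rewrite lee_fin.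
have ii T : mu.-integrable (cube_set Q) (EFin \o \1_(cube_set T)).
  by apply: integrableS (integrable_indic_cube T) => //; exact: measurable_cube.
apply: le_trans (_ : avgr (fun x =>
    \sum_(T <- s | `[< cube_set T `<=` cube_set Q >]) \1_(cube_set T) x) Q <= _).
  apply: le_avgr.
  - exact: cube_integrable_osc iD _ DQ.
  - by apply: integrable_sum_real => //; exact: measurable_cube.
  move=> x Qx; rewrite avgr_haar0_sum -sumrB; apply: le_trans (ler_norm_sum _ _ _) _.
  rewrite [leRHS]big_mkcond /= big_seq [leRHS]big_seq; apply: ler_sum => T Ts.
  case: asboolP => TQ; first by rewrite avgr_haar0_sub// subr0 haar0_norm.
  have [k kE] := haar0_cst (sD _ Ts) DQ TQ.
  by rewrite kE// (eq_avgr kE) -[fun _ => k]/(cst k) avgr_cst subrr normr0.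
rewrite avgr_sum// (eq_bigr (fun T => volr T / volr Q)); last first.
  by move=> T /asboolP TQ; rewrite avgr_indic.
by rewrite -mulr_suml ler_pdivrMr ?volr_gt0// sC.
Qed.

(** Otherwise the Haar coefficients would vanish, and one of them is 1. *)
Lemma haar0_sum_bmo_neq0 s Q : uniq s -> (forall T, T \in s -> D T) -> Q \in s ->
  bmo_norm D (haar0_sum s) != 0%E.
Proof.
move=> us sD Qs; apply/eqP => b0; have DQ := sD _ Qs.
have := haar_mean_haar0_sum us sD DQ bits_neq; rewrite Qs eqxx.
rewrite /haar_mean; under eq_bigr do
  rewrite (avgr_child_bmo0 n_gt0 hD (haar0_sum_loc_integrable s) b0 _ DQ).
rewrite -mulr_suml sum_haar_sign ?bits_neq// !mul0r => /eqP.
by rewrite eq_sym oner_eq0.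
Qed.

(** The product of the two normalized Haar coefficients at [Q] is 1 for [Q] in
    [s] and [eps] identically [false], and 0 otherwise. *)
Lemma paraproduct_haar0_sum s (g : Rn R n -> R) x : uniq s ->
  (forall T, T \in s -> D T) -> (forall x, 0 <= g x) ->
  paraproduct_comp D (haar0_sum s) (haar0_sum s) g x =
  (\sum_(Q <- s) avg (EFin \o g) Q * (\1_(cube_set Q) x)%:E)%E.
Proof.
move=> us sD g0.
have iD := @loc_integrable_cube _ _ D _ (haar0_sum_loc_integrable s).
have avg0 Q : (0 <= avg (EFin \o g) Q * (\1_(cube_set Q) x)%:E)%E.
  apply: mule_ge0; last by rewrite lee_fin indicE.
  by apply: avg_ge0 => y; rewrite lee_fin.
pose u Q := (if Q \in s then avg (EFin \o g) Q * (\1_(cube_set Q) x)%:E else 0)%E.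
have u0 Q : (0 <= u Q)%E by rewrite /u; case: ifP.
transitivity (sum_over D u).
  rewrite /paraproduct_comp /sum_over.
  have E Q : D Q -> (\sum_(eps : bits | eps != [ffun=> true])
      haar_coef (haar0_sum s) Q eps * haar_coef (haar0_sum s) Q eps *
      avg (EFin \o g) Q * ((\1_(cube_set Q) x)%:E / vol Q))%E = u Q.
    move=> DQ; rewrite /u.
    under eq_bigr => eps e1 do rewrite paraproduct_term ?iD// haar_mean_haar0_sum//.
    case: (boolP (Q \in s)) => Qs /=; last first.
      by rewrite big1// => eps _; rewrite mul0r mul0e.
    rewrite (bigD1 [ffun=> false]) ?bits_neq//= eqxx mul1r mul1e big1 ?adde0//.
    by move=> eps /andP[_ /negbTE ->]; rewrite mul0r mul0e.
  by congr (_ - _)%E; apply: eq_esum => Q DQ; rewrite ?funeposE ?funenegE E.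
rewrite sum_over_ge0// -esum_seq//.
transitivity (\esum_(i in D `&` [set` s]) (avg (EFin \o g) i * (\1_(cube_set i) x)%:E))%E.
  by rewrite esum_mkcondr; apply: eq_esum => Q _; rewrite mem_setE.
by rewrite setIidr// => Q /= /sD.
Qed.

End grid.
End test_function.

(** * The two inequalities *)

Section constants.
Context (R : realType) (n : nat).
Variable Lambda : R.
Hypothesis L1 : 1 < Lambda.

Definition stopping_ratio : R := 2 * Lambda / (Lambda - 1).

(** The Carleson constant of the coefficients of [Pi_a^* Pi_b] when [a] and [b]
    have norm 1: [2 ^+ n] signs, each at the cost of [8 * 4 ^+ n] given by
    [bmo_variation]. *)
Definition carleson_const : R := 8 * 8 ^+ n.

Lemma stopping_ratio_gt2 : 2 < stopping_ratio.
Proof.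
by rewrite /stopping_ratio ltr_pdivlMr ?subr_gt0//; have := L1; lra.
Qed.

Lemma carleson_const_ge1 : 1 <= carleson_const.
Proof. by rewrite mulr_ege1// ?exprn_ege1// ler1n. Qed.

(** The two stopping rules may each use half of the volume that the Carleson
    constant [Lambda] leaves below a selected cube. *)
Lemma stopping_budget : 1 / stopping_ratio +
  carleson_const / (carleson_const * stopping_ratio) <= (Lambda - 1) / Lambda.
Proof.
have L0 : Lambda != 0 by rewrite gt_eqF// (lt_trans _ L1).
have L10 : Lambda - 1 != 0 by rewrite gt_eqF// subr_gt0.
have A0 : carleson_const != 0.
  by rewrite gt_eqF// (lt_le_trans _ carleson_const_ge1).
rewrite le_eqVlt; apply/orP; left; apply/eqP; rewrite /stopping_ratio; field.
by rewrite L0 L10 A0.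
Qed.

End constants.

Section directions.
Context (R : realType) (n : nat).
Local Notation mu := (leb R n).
Implicit Types (P Q T : cube R n) (x : Rn R n) (s S : seq (cube R n)).
Variables (D : set (cube R n)) (p Lambda : R) (w : weight R n).
Hypothesis n_gt0 : (0 < n)%N.
Hypothesis hD : dyadic_grid D.
Hypothesis p1 : 1 < p.
Hypothesis L1 : 1 < Lambda.

(** The Carleson condition for finite families, without extended reals. *)
Definition seq_carleson S : Prop := forall T, D T ->
  \sum_(P <- S | `[< cube_set P `<=` cube_set T >]) volr P <= Lambda * volr T.

Lemma esum_vol_seq S T : uniq S ->
  (\esum_(P in [set P | [set` S] P /\ cube_set P `<=` cube_set T]) vol P =
   (\sum_(P <- S | `[< cube_set P `<=` cube_set T >]) volr P)%:E)%E.
Proof.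
move=> uS; rewrite -big_filter -sumEFin -esum_seq; last 2 first.
- exact: filter_uniq.
- by move=> P; rewrite lee_fin ltW// volr_gt0.
rewrite (_ : [set P | _] = [set` [seq P <- S | `[< cube_set P `<=` cube_set T >]]]).
  by apply: eq_esum => P _; rewrite volrE.
apply/seteqP; split=> P /=; rewrite mem_filter.
  by move=> [PS PT]; rewrite PS andbT; exact/asboolP.
by move=> /andP[/asboolP].
Qed.

Lemma carleson_seq S : uniq S -> seq_carleson S -> carleson D Lambda [set` S].
Proof.
by move=> uS cS T DT; rewrite esum_vol_seq// volrE -EFinM lee_fin cS.
Qed.

Lemma seq_carleson_sub (S : set (cube R n)) s : carleson D Lambda S -> uniq s ->
  (forall Q, Q \in s -> S Q) -> seq_carleson s.
Proof.
move=> cS us sS T DT; rewrite -lee_fin EFinM -volrE -esum_vol_seq//.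
apply: le_trans (cS T DT); apply: ge_ereal_sup => _ [A [finA As] <-].
apply: ereal_sup_ubound; exists A => //; split=> // P /As /= [Ps PT].
by split=> //; exact: sS.
Qed.

Lemma seq_carleson1 Q : seq_carleson [:: Q].
Proof.
move=> T DT; have v0 := volr_gt0 T.
rewrite big_cons big_nil; case: asboolP => QT; last by rewrite mulr_ge0 ?ltW// (lt_trans _ L1).
rewrite addr0; apply: le_trans (_ : volr T <= _).
  by rewrite volr_le// sub_level.
by rewrite ler_peMl// ltW.
Qed.

Lemma seq_no_chain S : ~ infinite_increasing_chain [set` S].
Proof.
move=> [q [qS qlt]].
have mono i j : (i < j)%N -> cube_set (q i) `<` cube_set (q j).
  elim: j => // j IH; rewrite ltnS leq_eqVlt => /orP[/eqP ->//|/IH h].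
  have [[h1 h2] [g1 _]] := (h, qlt j); split; first exact: subset_trans g1.
  by move=> g; apply: h2; exact: subset_trans g1 g.
have qinj : injective q.
  by move=> i j e; case: (ltngtP i j) => // /mono[_ []]; rewrite e.
have : (size (map q (iota 0 (size S).+1)) <= size S)%N.
  apply: uniq_leq_size; first by rewrite map_inj_uniq// iota_uniq.
  by move=> _ /mapP[i _ ->]; exact: qS.
by rewrite size_map size_iota ltnn.
Qed.

Local Open Scope ereal_scope.
Local Notation nu := [the {measure set Rn R n -> \bar R} of wdx w].
Local Notation normf f := (fun x => `|f x|%R).

Let p0 : (0 < p)%R. Proof. exact: lt_trans p1. Qed.

(** The functions over which [opnorm nu p] is a supremum. *)
Definition unit_ball (f : Rn R n -> R) : Prop :=
  f \in Lfun nu p%:E /\ 'N[nu]_p%:E[EFin \o f] <= 1.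

Lemma unit_ball_norm f : unit_ball f -> unit_ball (normf f).
Proof.
have E : 'N[nu]_p%:E[EFin \o normf f] = 'N[nu]_p%:E[EFin \o f].
  by rewrite -[RHS]Lnorm_abse.
move=> [/andP[]]; rewrite !inE /= => mf nf f1; split; last by rewrite E.
apply/andP; split; rewrite !inE /=; first exact: measurableT_comp.
by move: nf; rewrite /finite_norm E.
Qed.

Lemma unit_ball_measurable f : unit_ball f -> measurable_fun setT f.
Proof. by move=> [/andP[]]; rewrite !inE. Qed.

Lemma le_sup_sparse S f : uniq S -> (forall Q, Q \in S -> D Q) -> seq_carleson S ->
  unit_ball f -> 'N[nu]_p%:E[(fun x =>
    \sum_(Q <- S) avg (EFin \o normf f) Q * (\1_(cube_set Q) x)%:E)] <=
  sup_sparse D Lambda p w.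
Proof.
move=> uS SD cS /unit_ball_norm uf.
have a0 Q x : 0 <= avg (EFin \o normf f) Q * (\1_(cube_set Q) x)%:E.
  by rewrite mule_ge0 ?lee_fin ?indicE//; apply: avg_ge0 => y; rewrite lee_fin.
apply: le_trans (_ : opnorm nu p (sparse_op [set` S]) <= _).
  apply: ereal_sup_ubound; exists (normf f) => //.
  by congr Lnorm; apply/funext => x; rewrite /sparse_op sum_over_ge0// esum_seq.
apply: ereal_sup_ubound; exists [set` S] => //; split.
- by move=> Q /= /SD.
- exact: carleson_seq.
- exact: seq_no_chain.
Qed.

Lemma wdx_cube_gt0 Q : 0 < wdx w (cube_set Q).
Proof.
rewrite lt0e measure_ge0 andbT; apply/eqP => w0.
have mQ := measurable_cube Q.
have mw : measurable_fun (cube_set Q) (EFin \o w).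
  by apply/measurable_EFinP; apply: measurable_funTS; have [] := weight_loc_integrable w.
have aew : \forall x \ae mu, (0 < w x)%R := weight_ae_gt0 w.
have : \int[mu]_(x in cube_set Q) `|(EFin \o w) x| = 0.
  rewrite -w0; apply: ae_eq_integral => //; first exact: measurableT_comp.
  apply: filterS aew => x wx _ /=; by rewrite gtr0_norm.
move=> /(ae_eq_integral_abs mu mQ mw) ae0.
have : mu.-negligible (cube_set Q).
  have : \forall x \ae mu, ~ cube_set Q x.
    by apply: filterS2 aew ae0 => x wx + Qx => /(_ Qx) [] wx0; rewrite wx0 ltxx in wx.
  by apply: negligibleS => x Qx /=; apply.
move=> /((negligibleP mu mQ)); rewrite (_ : _ (cube_set Q) = (volr Q)%:E); last exact: volrE.
by move=> /eqP; rewrite eqe gt_eqF// volr_gt0.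
Qed.

(** If the average of [|f|] over [Q] is infinite, then the sparse operator of the
    single cube [Q] sends [|f|] to a function that is infinite on [Q], a set of
    positive measure. So when the supremum over sparse families is finite, all
    functions of the unit ball have finite averages. *)
Lemma avg_lty f Q : unit_ball f -> D Q -> sup_sparse D Lambda p w < +oo ->
  avg (EFin \o normf f) Q < +oo.
Proof.
move=> uf DQ; apply: contraTT; rewrite -!leNgt !leye_eq => /eqP ay.
have sD T : T \in [:: Q] -> D T by rewrite inE => /eqP ->.
have := @le_sup_sparse [:: Q] f isT sD (@seq_carleson1 Q) uf.
suff -> : 'N[nu]_p%:E[(fun x =>
    \sum_(Q <- [:: Q]) avg (EFin \o normf f) Q * (\1_(cube_set Q) x)%:E)] = +oo.
  by rewrite leye_eq.
rewrite unlock; apply: eqy_poweR; first by rewrite invr_gt0.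
transitivity (\int[nu]_(x in cube_set Q) cst +oo x).
  rewrite [RHS]integral_mkcond; apply: eq_integral => x _.
  rewrite big_seq1 ay patchE indicE; case: ifP => _.
    by rewrite mule1 gee0_abs// poweRyr// gt_eqF.
  by rewrite mule0 abse0 poweR0r// gt_eqF.
rewrite integral_cst; last exact: measurable_cube.
by rewrite gt0_mulye//; exact: wdx_cube_gt0.
Qed.

Lemma unit_ball_cube_integrable f : unit_ball f -> sup_sparse D Lambda p w < +oo ->
  cube_integrable D f.
Proof.
move=> uf sy Q DQ; apply/integrableP; split.
  by apply/measurable_EFinP; apply: measurable_funTS; exact: unit_ball_measurable.
suff : \int[mu]_(x in cube_set Q) (EFin \o normf f) x < +oo by [].
have i0 : 0 <= \int[mu]_(x in cube_set Q) (EFin \o normf f) x.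
  by apply: integral_ge0 => x _; rewrite lee_fin.
have := avg_lty uf DQ sy; rewrite /avg volrE inver gt_eqF ?volr_gt0//.
have v0 : (0 < (volr Q)^-1)%R by rewrite invr_gt0 volr_gt0.
case: (\int[mu]_(x in cube_set Q) (EFin \o normf f) x) i0 => [r _ _| |] //=.
  exact: ltry.
by move=> _; rewrite gt0_mulye.
Qed.

Local Notation K := (stopping_ratio Lambda).
Local Notation A := (carleson_const R n).
Local Notation M := (A * K)%R.

Let K2 : (2 < K)%R := stopping_ratio_gt2 L1.
Let K0 : (0 < K)%R. Proof. exact: lt_trans K2. Qed.
Let A1 : (1 <= A)%R := carleson_const_ge1 R n.
Let M0 : (0 < M)%R. Proof. by rewrite mulr_gt0// (lt_le_trans _ A1). Qed.
Let KM : (1 / K + A / M <= (Lambda - 1) / Lambda)%R := stopping_budget n L1.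

(** The coefficients of the operator are dominated by the squared martingale
    differences of [a] and [b], which satisfy a Carleson condition, so that
    [sparse_domination] applies to each finite partial sum. *)
Lemma paraproduct_le_sparse a b (Ba Bb : R) f : loc_integrable a -> loc_integrable b ->
  bmo_norm D a = Ba%:E -> bmo_norm D b = Bb%:E -> (0 < Ba)%R -> (0 < Bb)%R ->
  unit_ball f -> sup_sparse D Lambda p w < +oo ->
  'N[nu]_p%:E[paraproduct_comp D a b f] <=
  (K * M * (Ba * Bb))%:E * sup_sparse D Lambda p w.
Proof.
move=> la lb aB bB Ba0 Bb0 uf sy.
have ia := @loc_integrable_cube _ _ D _ la.
have ib := @loc_integrable_cube _ _ D _ lb.
have jf := unit_ball_cube_integrable uf sy.
pose F Q := avgr (normf f) Q.
pose W Q := (variation (avgr a) Q / Ba ^+ 2 + variation (avgr b) Q / Bb ^+ 2)%R.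
pose alpha Q := (2 ^+ n / 2 * W Q)%R.
have F0 Q : (0 <= F Q)%R by apply: avgr_ge0 => x.
have V0 (g : cube R n -> R) Q : (0 <= variation g Q)%R.
  by apply: sumr_ge0 => c _; rewrite divr_ge0 ?sqr_ge0 ?exprn_ge0.
have al0 Q : (0 <= alpha Q)%R.
  by rewrite mulr_ge0 ?divr_ge0 ?exprn_ge0// addr_ge0// divr_ge0 ?V0 ?sqr_ge0.
have mF : mean_value D F := mean_value_avgr (cube_integrable_norm jf).
have alA : tree_carleson D alpha A.
  move=> N Q DQ.
  have ha := bmo_variation n_gt0 hD la aB Ba0 N DQ.
  have hb := bmo_variation n_gt0 hD lb bB Bb0 N DQ.
  have -> : (\sum_(P <- tree N Q) alpha P * volr P = 2 ^+ n / 2 *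
      ((\sum_(P <- tree N Q) variation (avgr a) P * volr P) / Ba ^+ 2 +
       (\sum_(P <- tree N Q) variation (avgr b) P * volr P) / Bb ^+ 2))%R.
    rewrite !mulr_suml -big_split mulr_sumr; apply: eq_bigr => P _.
    by rewrite /alpha /W /=; ring.
  have A2 : A = (2 ^+ n / 2 * (8 * 4 ^+ n + 8 * 4 ^+ n))%R.
    rewrite /carleson_const (_ : 8 ^+ n = 2 ^+ n * 4 ^+ n)%R; last by rewrite -exprMn; congr (_ ^+ n)%R; ring.
    by field.
  rewrite A2 -[leRHS]mulrA ler_pM2l; last by rewrite divr_gt0// exprn_gt0.
  rewrite mulrDl; apply: lerD.
    by rewrite ler_pdivrMr ?exprn_gt0// mulrAC.
  by rewrite ler_pdivrMr ?exprn_gt0// mulrAC.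
pose u Q := (Ba * Bb * (alpha Q * F Q))%:E.
have u0 Q : 0 <= u Q.
  by rewrite lee_fin; exact: mulr_ge0 (mulr_ge0 (ltW Ba0) (ltW Bb0)) (mulr_ge0 (al0 Q) (F0 Q)).
apply: le_trans (_ : 'N[nu]_p%:E[(fun x =>
    \esum_(Q in D) (u Q * (\1_(cube_set Q) x)%:E))] <= _).
  apply: (le_Lnorm _ p0) => x; apply: le_trans (abse_sum_over _ _) _.
  rewrite gee0_abs; last first.
    by apply: esum_ge0 => Q _; rewrite mule_ge0// lee_fin indicE.
  apply: le_esum => Q DQ; rewrite (avgE (jf _ DQ)).
  under eq_bigr do rewrite paraproduct_term ?ia ?ib// -!EFinM.
  rewrite sumEFin -mulr_suml -EFinM /= lee_fin normrM.
  have F1 : (`|avgr f Q * \1_(cube_set Q) x| <= F Q * \1_(cube_set Q) x)%R.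
    rewrite normrM [(`|\1_ _ _|)%R]ger0_norm ?indicE//.
    by rewrite ler_wpM2r//; exact: normr_avgr (jf _ DQ).
  rewrite [leRHS](_ : _ = (alpha Q * (Ba * Bb)) * (F Q * \1_(cube_set Q) x))%R; last by ring.
  apply: ler_pM => //; apply: le_trans (ler_norm_sum _ _ _) _.
  exact: sum_haar_mean_le.
apply: (Lnorm_esum p0) => //; first exact: countable_grid hD.
move=> s us sD.
have K1 : (1 <= K)%R by rewrite ltW// (lt_trans _ K2)// ltr1n.
have AM : (A <= M)%R by rewrite ler_peMr// (le_trans ler01).
have [S [uS SD cS dom]] := sparse_domination n_gt0 hD al0 F0 mF alA K1
  (le_trans ler01 A1) AM M0 L1 KM us sD.
apply: le_trans (_ : 'N[nu]_p%:E[(fun x => (K * M * (Ba * Bb))%:E *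
   \sum_(Q <- S) avg (EFin \o normf f) Q * (\1_(cube_set Q) x)%:E)] <= _).
  apply: (le_Lnorm _ p0) => x.
  have -> : \sum_(Q <- s) u Q * (\1_(cube_set Q) x)%:E =
    (Ba * Bb * \sum_(Q <- s) alpha Q * F Q * \1_(cube_set Q) x)%:E.
    rewrite mulr_sumr -sumEFin; apply: eq_bigr => Q _.
    by rewrite /u -EFinM; congr EFin; ring.
  have -> : \sum_(Q <- S) avg (EFin \o normf f) Q * (\1_(cube_set Q) x)%:E =
    (\sum_(Q <- S) F Q * \1_(cube_set Q) x)%:E.
    rewrite -sumEFin big_seq [RHS]big_seq; apply: eq_bigr => Q QS.
    by rewrite avgE//; apply: cube_integrable_norm jf _ (SD _ QS).
  rewrite -EFinM /= lee_fin !ger0_norm.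
  - rewrite (_ : K * M * (Ba * Bb) * _ = Ba * Bb * (K * M *
      \sum_(Q <- S) F Q * \1_(cube_set Q) x))%R; last by ring.
    by rewrite ler_pM2l ?mulr_gt0//.
  - rewrite mulr_ge0 ?sumr_ge0// => [|Q _]; last by rewrite mulr_ge0// indicE.
    exact: ltW (mulr_gt0 (mulr_gt0 K0 M0) (mulr_gt0 Ba0 Bb0)).
  - rewrite mulr_ge0 ?sumr_ge0// => [|Q _]; first by rewrite mulr_ge0 ?ltW.
    apply: mulr_ge0; first exact: mulr_ge0 (al0 Q) (F0 Q).
    by rewrite indicE.
have c0 : (0 <= K * M * (Ba * Bb))%R.
  exact: ltW (mulr_gt0 (mulr_gt0 K0 M0) (mulr_gt0 Ba0 Bb0)).
rewrite LnormZl//; last exact: measurable_seq_sum.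
by rewrite lee_wpmul2l ?lee_fin//; exact: le_sup_sparse.
Qed.

Lemma sup_paraproduct_le :
  sup_paraproduct D p w <= (K * M)%:E * sup_sparse D Lambda p w.
Proof.
have KM0 : (0 < K * M)%R by exact: mulr_gt0.
have [sy|] := ltP (sup_sparse D Lambda p w) +oo; last first.
  by rewrite leye_eq => /eqP ->; rewrite gt0_muley ?lte_fin// leey.
apply: ge_ereal_sup => _ [[a b] [/= [la ay] [lb byy] an bn] <-].
have [Q [DQ _ _]] := grid_cover hD 0 [tuple (0%R : measurableTypeR R) | i < n].
have exD : exists Q, D Q by exists Q.
have fin g : loc_integrable g -> bmo_norm D g < +oo -> bmo_norm D g != 0 ->
    exists2 B : R, (0 < B)%R & bmo_norm D g = B%:E.
  move=> lg gy gn; have g0 := bmo_norm_ge0 exD (@loc_integrable_cube _ _ D _ lg).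
  exists (fine (bmo_norm D g)); last by rewrite fineK// ge0_fin_numE.
  by rewrite fine_gt0// gy andbT lt0e gn.
have [Ba Ba0 aE] := fin _ la ay an; have [Bb Bb0 bE] := fin _ lb byy bn.
rewrite aE bE -EFinM inver gt_eqF ?mulr_gt0// lee_pdivrMr ?mulr_gt0//.
rewrite muleAC -EFinM; apply: ge_ereal_sup => _ [f /= uf <-].
exact: paraproduct_le_sparse.
Qed.

(** For nonempty [s] the function on the left is [Pi_a^* Pi_a] applied to [|f|],
    for [a] the sum of the Haar functions of [s]. For empty [s] the claim is that
    the right-hand side is nonnegative, which follows from the case of one cube. *)
Lemma sparse_le_paraproduct_seq s f : uniq s -> (forall Q, Q \in s -> D Q) ->
  seq_carleson s -> unit_ball f ->
  'N[nu]_p%:E[(fun x =>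
    \sum_(Q <- s) avg (EFin \o normf f) Q * (\1_(cube_set Q) x)%:E)] <=
  (Lambda ^+ 2)%:E * sup_paraproduct D p w.
Proof.
have nonempty t g Q : uniq t -> (forall Q, Q \in t -> D Q) -> Q \in t ->
    seq_carleson t -> unit_ball g ->
    'N[nu]_p%:E[(fun x =>
      \sum_(Q <- t) avg (EFin \o normf g) Q * (\1_(cube_set Q) x)%:E)] <=
    (Lambda ^+ 2)%:E * sup_paraproduct D p w.
  move=> ut tD Qt ct /unit_ball_norm ug.
  pose a := haar0_sum t; have la : loc_integrable a := haar0_sum_loc_integrable t.
  have aL : bmo_norm D a <= Lambda%:E := haar0_sum_bmo n_gt0 hD ut tD ct.
  have an : bmo_norm D a != 0 := haar0_sum_bmo_neq0 n_gt0 hD ut tD Qt.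
  have a0 : 0 <= bmo_norm D a.
    by apply: bmo_norm_ge0; [exists Q; exact: tD|exact: loc_integrable_cube].
  have ay : bmo_norm D a < +oo := le_lt_trans aL (ltry _).
  have [B BE] : exists B : R, bmo_norm D a = B%:E.
    by exists (fine (bmo_norm D a)); rewrite fineK// ge0_fin_numE.
  have B0 : (0 < B)%R by rewrite -lte_fin -BE lt0e an.
  have BL : (B <= Lambda)%R by rewrite -lee_fin -BE.
  set N := 'N[nu]_p%:E[_].
  have h1 : N <= opnorm nu p (paraproduct_comp D a a).
    apply: ereal_sup_ubound; exists (normf g) => //.
    by congr Lnorm; apply/funext => x; rewrite (paraproduct_haar0_sum n_gt0 hD).
  have h2 : opnorm nu p (paraproduct_comp D a a) / (B * B)%:E <= sup_paraproduct D p w.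
    apply: ereal_sup_ubound; exists (a, a); last by rewrite /= BE EFinM.
    by split.
  have BB : (0 < B * B)%R by rewrite mulr_gt0.
  rewrite inver gt_eqF// in h2.
  have h2' := h2; rewrite lee_pdivrMr// in h2.
  apply: (le_trans h1); apply: (le_trans h2); rewrite muleC.
  apply: lee_wpmul2r; last by rewrite lee_fin expr2; apply: ler_pM => //; exact: ltW.
  apply: le_trans h2'.
  by apply: mule_ge0; [exact: (le_trans (Lnorm_ge0 _ _ _) h1)|rewrite lee_fin invr_ge0 ltW].
case: s => [|Q s] us sD cs uf; last by apply: (nonempty _ _ Q) => //; exact: mem_head.
have [Q [DQ _ _]] := grid_cover hD 0 [tuple (0%R : measurableTypeR R) | i < n].
have sD' T : T \in [:: Q] -> D T by rewrite inE => /eqP ->.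
have := nonempty [:: Q] f Q isT sD' (mem_head _ _) (@seq_carleson1 Q) uf.
apply: le_trans; apply: (le_Lnorm _ p0) => x.
by rewrite big_nil abse0.
Qed.

Lemma sup_sparse_le :
  sup_sparse D Lambda p w <= (Lambda ^+ 2)%:E * sup_paraproduct D p w.
Proof.
apply: ge_ereal_sup => _ [S [SD cS _] <-]; apply: ge_ereal_sup => _ [f /= uf <-].
have mf := unit_ball_measurable uf.
have a0 Q : 0 <= avg (EFin \o normf f) Q by apply: avg_ge0 => y; rewrite lee_fin.
apply: le_trans (_ : 'N[nu]_p%:E[(fun x =>
    \esum_(Q in S) (avg (EFin \o normf f) Q * (\1_(cube_set Q) x)%:E))] <= _).
  apply: (le_Lnorm _ p0) => x; apply: le_trans (abse_sum_over _ _) _.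
  rewrite gee0_abs; last by apply: esum_ge0 => Q _; rewrite mule_ge0// lee_fin indicE.
  apply: le_esum => Q _; rewrite abseM [X in _ * X]gee0_abs ?lee_fin ?indicE//.
  apply: lee_wpmul2r; first by rewrite lee_fin.
  rewrite /avg abseM volrE inver gt_eqF ?volr_gt0//.
  have v0 : 0 <= ((volr Q)^-1)%:E by rewrite lee_fin invr_ge0 ltW// volr_gt0.
  rewrite [X in _ * X]gee0_abs//; apply: lee_wpmul2r => //.
  apply: (le_abse_integral mu (measurable_cube Q)).
  by apply/measurable_EFinP; exact: measurable_funTS.
apply: (Lnorm_esum p0) => //.
  exact: sub_countable (subset_card_le SD) (countable_grid hD).
move=> s us sS; apply: sparse_le_paraproduct_seq => //.
  by move=> Q /sS /SD.
exact: seq_carleson_sub cS us sS.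
Qed.

End directions.

Theorem mainTheorem10 (R : realType) (n : nat) (p Lambda : R)
    (hn : (0 < n)%N) (hp : 1 < p) (hLambda : 1 < Lambda) :
  exists c C : R, [/\ 0 < c, c <= C &
    forall D : set (cube R n), dyadic_grid D ->
    forall w : weight R n, Ap D p w ->
      (c%:E * sup_paraproduct D p w <= sup_sparse D Lambda p w)%E /\
      (sup_sparse D Lambda p w <= C%:E * sup_paraproduct D p w)%E].
Proof.
set K := stopping_ratio Lambda; set A := carleson_const R n.
have K1 : 1 <= K by rewrite ltW// (lt_trans _ (stopping_ratio_gt2 hLambda))// ltr1n.
have A1 : 1 <= A := carleson_const_ge1 R n.
have KM1 : 1 <= K * (A * K) := mulr_ege1 K1 (mulr_ege1 A1 K1).
have KM0 : 0 < K * (A * K) := lt_le_trans ltr01 KM1.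
exists (K * (A * K))^-1, (Lambda ^+ 2); split.
- by rewrite invr_gt0.
- apply: (@le_trans _ _ 1); first by rewrite invf_le1.
  by rewrite exprn_ege1// ltW.
move=> D hD w _; split; last exact: sup_sparse_le.
by rewrite lee_pdivrMl//; exact: sup_paraproduct_le.
Qed.
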